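(* Let $k\in\mathbb{Z}\setminus\{0\}$ and let $f\colon\mathbb{T}^2\to\mathbb{T}^2$ be a homeomorphism isotopic to the $k$-Dehn twist $I_k$ and having small wandering domains. Then $f$ admits an irrational circle rotation as a topological factor if and only if, given any lift $\tilde f\colon\mathbb{R}^2\to\mathbb{R}^2$ of $f$, there exist $\rho\in\mathbb{R}\setminus\mathbb{Q}$ and $C>0$ such that $$\left|\mathrm{pr}_2\big(\tilde f^n(z)-z\big)-n\rho\right|\leq C,\quad\forall z\in\mathbb{R}^2,\ \forall n\in\mathbb{Z},$$ where $\mathrm{pr}_2\colon\mathbb{R}^2\ni(x,y)\mapsto y$.
   Context: $\mathbb{T}=\mathbb{R}/\mathbb{Z}$, $\mathbb{T}^2=\mathbb{R}^2/\mathbb{Z}^2$ with quotient projection $\pi\colon\mathbb{R}^2\to\mathbb{T}^2$ and the distance induced by the Euclidean one. $I_k=\begin{pmatrix}1&k\\0&1\end{pmatrix}\in\mathrm{SL}(2,\mathbb{Z})$, and the $k$-Dehn twist is the homeomorphism of $\mathbb{T}^2$ induced by $I_k$. $f$ admits an irrational circle rotation as a topological factor if there are an irrational $\alpha\in\mathbb{R}$ and a continuous surjective map $h\colon\mathbb{T}^2\to\mathbb{T}$ with $h\circ f=T_\alpha\circ h$, where $T_\alpha\colon\mathbb{T}\to\mathbb{T}$ is the rotation by $\alpha$ mod $\mathbb{Z}$. An open set $U$ is wandering for $f$ if $f^n(U)\cap U=\emptyset$ for every $n\in\mathbb{Z}\setminus\{0\}$. $\Omega(f)$ is the set of points having no wandering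 neighborhood and $\mathscr{W}(f)=\mathbb{T}^2\setminus\Omega(f)$. A connected open set $U\subset\mathbb{T}^2$ is lift-bounded if every connected component of $\pi^{-1}(U)$ is bounded in $\mathbb{R}^2$. $f$ has small wandering domains if every connected component of $\mathscr{W}(f)$ is lift-bounded and, for every $\delta>0$, only finitely many connected components of $\mathscr{W}(f)$ have diameter $\geq\delta$. *)

(* Defs.v *)
From HB Require Import structures.
From mathcomp Require Import all_boot all_order all_algebra generic_quotient.
From mathcomp Require Import all_classical all_reals all_analysis.

Set Implicit Arguments.
Unset Strict Implicit.
Unset Printing Implicit Defensive.

Import Order.TTheory GRing.Theory Num.Theory.
Import numFieldNormedType.Exports.

Local Open Scope classical_set_scope.
Local Open Scope ring_scope.
Local Open Scope quotient_scope.

Section circle.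
Variable R : realType.

Definition eqmodZ : rel R := fun x y => x - y \is a Num.int.

Lemma eqmodZ_refl : reflexive eqmodZ.
Proof. by move=> x; rewrite /eqmodZ subrr rpred0. Qed.

Lemma eqmodZ_sym : symmetric eqmodZ.
Proof. by move=> x y; rewrite /eqmodZ -rpredN opprB. Qed.

Lemma eqmodZ_trans : transitive eqmodZ.
Proof.
move=> y x z; rewrite /eqmodZ => xy yz.
have -> : x - z = (x - y) + (y - z) by rewrite addrA subrK.
exact: rpredD.
Qed.

Canonical eqmodZ_equiv := EquivRel eqmodZ eqmodZ_refl eqmodZ_sym eqmodZ_trans.

Definition circle : Type := quotient_topology {eq_quot eqmodZ}.
HB.instance Definition _ := Topological.on circle.
HB.instance Definition _ := Quotient.on circle.

Definition rotation (a : R) (t : circle) : circle :=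
  \pi_circle (repr t + a).

Lemma eq_pi_circle x y : (\pi_circle x = \pi_circle y) <-> eqmodZ x y.
Proof. by split => [/eqmodP|h]; [|apply/eqmodP]. Qed.

Lemma rotationE a x : rotation a (\pi_circle x) = \pi_circle (x + a).
Proof.
apply/eq_pi_circle; rewrite /eqmodZ opprD addrACA subrr addr0.
by apply/eq_pi_circle; rewrite reprK.
Qed.

End circle.

Section torus.
Variable R : realType.

Definition eqmodZ2 : rel (R * R) := fun z w => eqmodZ z.1 w.1 && eqmodZ z.2 w.2.

Lemma eqmodZ2_refl : reflexive eqmodZ2.
Proof. by move=> x; rewrite /eqmodZ2 !eqmodZ_refl. Qed.

Lemma eqmodZ2_sym : symmetric eqmodZ2.
Proof.
by move=> x y; rewrite /eqmodZ2 [eqmodZ x.1 _]eqmodZ_sym [eqmodZ x.2 _]eqmodZ_sym.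
Qed.

Lemma eqmodZ2_trans : transitive eqmodZ2.
Proof.
move=> y x z /andP[xy1 xy2] /andP[yz1 yz2].
by apply/andP; split; [exact: eqmodZ_trans yz1|exact: eqmodZ_trans yz2].
Qed.

Canonical eqmodZ2_equiv :=
  EquivRel eqmodZ2 eqmodZ2_refl eqmodZ2_sym eqmodZ2_trans.

Definition torus : Type := quotient_topology {eq_quot eqmodZ2}.
HB.instance Definition _ := Topological.on torus.
HB.instance Definition _ := Quotient.on torus.

Lemma eq_pi_torus z w : (\pi_torus z = \pi_torus w) <-> eqmodZ2 z w.
Proof. by split => [/eqmodP|h]; [|apply/eqmodP]. Qed.

Definition dehn_twist (k : int) (p : torus) : torus :=
  \pi_torus ((repr p).1 + k%:~R * (repr p).2, (repr p).2).

Lemma dehn_twistE k z :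
  dehn_twist k (\pi_torus z) = \pi_torus (z.1 + k%:~R * z.2, z.2).
Proof.
have /eq_pi_torus/andP[h1 h2] : \pi_torus (repr (\pi_torus z)) = \pi_torus z.
  by rewrite reprK.
apply/eq_pi_torus; rewrite /eqmodZ2 /= h2 andbT /eqmodZ opprD addrACA -mulrBr.
by rewrite rpredD// rpredM// intr_int.
Qed.

(* On R * R the library norm is the max norm, hence the explicit formula. *)
Definition euclid_dist (z w : R * R) : R :=
  Num.sqrt ((z.1 - w.1) ^+ 2 + (z.2 - w.2) ^+ 2).

Definition torus_dist (p q : torus) : R :=
  inf [set euclid_dist z w | z in [set z | \pi_torus z = p]
                           & w in [set w | \pi_torus w = q]].

Definition torus_diam (U : set torus) : R :=
  sup [set torus_dist p q | p in U & q in U].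

End torus.

Definition is_homeo {S T : topologicalType} (f : S -> T) : Prop :=
  continuous f /\
  exists g : T -> S, [/\ continuous g, cancel f g & cancel g f].

(* The n-th iterate of g for n in Z; meaningful when g is bijective, in which
   case 'pinv_id setT g is the inverse of g. *)
Definition iterz {T : Type} (g : T -> T) (n : int) : T -> T :=
  match n with
  | Posz m => iter m g
  | Negz m => iter m.+1 ('pinv_id setT g)
  end.

Definition is_component {T : topologicalType} (A C : set T) : Prop :=
  exists2 x, A x & C = connected_component A x.

(* The isotopy H is only constrained at times t in [0, 1]. *)
Definition isotopic {T : topologicalType} (R : realType) (f g : T -> T) : Prop :=
  exists H : R * T -> T,
    [/\ {within [set tx : R * T | tx.1 \in `[0, 1]], continuous H},
        (forall t, t \in `[0, 1] -> is_homeo (fun x => H (t, x))),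
        (forall x, H (0, x) = f x) &
        (forall x, H (1, x) = g x)].

Definition wandering {T : topologicalType} (f : T -> T) (U : set T) : Prop :=
  open U /\ forall n : int, n != 0 -> (iterz f n @` U) `&` U = set0.

Definition nonwandering_set {T : topologicalType} (f : T -> T) : set T :=
  [set p | ~ exists2 U, wandering f U & U p].

Definition wandering_set {T : topologicalType} (f : T -> T) : set T :=
  ~` nonwandering_set f.

Section torus_dynamics.
Variable R : realType.
Local Notation torus := (torus R).

Definition lift_bounded (U : set torus) : Prop :=
  [/\ connected U, open U &
    forall C : set (R * R), is_component (\pi_torus @^-1` U) C ->
      bounded_set C].

Definition small_wandering_domains (f : torus -> torus) : Prop :=
  (forall C, is_component (wandering_set f) C -> lift_bounded C) /\
  (forall delta : R, 0 < delta ->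
     finite_set [set C | is_component (wandering_set f) C /\
                         delta <= torus_diam C]).

Definition is_lift (f : torus -> torus) (F : R * R -> R * R) : Prop :=
  continuous F /\ forall z, \pi_torus (F z) = f (\pi_torus z).

Definition irrational_rotation_factor (f : torus -> torus) : Prop :=
  exists (a : R) (h : torus -> circle R),
    [/\ irrational a, continuous h, (forall t, exists p, h p = t) &
        forall p, h (f p) = rotation a (h p)].

End torus_dynamics.

(* Main.v *)
(** A factor map lifts to [H : R^2 -> R] with [H (z + m) = H z + <v, m>]; since
    [H o F] and [H] differ by a constant, [v] is fixed by the transposed twist, so
    [v = (0, b)], [H] is within bounded distance of [b y], and the deviation bound
    holds with [rho = (alpha + j) / b].

    Conversely, let [g] range over the maps [F^n + m], with displacement
    [d = n rho + m_2]. A function [phi] satisfying [phi (g z) = phi z + d] is obtained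
    on the nonwandering set by taking a supremum along orbits, and it is extended to
    each wandering component. The components shrink along orbits, so Baire's theorem
    gives a nonwandering point [p] in the closure of no component at which [phi] is
    continuous. Some [g] returns a point [x] of a small ball at [p] to this ball, and
    the segment from [x] to [g x] generates a [g]-invariant vertical line. The vertical
    translate of this line is sheared by [g] because [k <> 0], so the two lines cross up
    to horizontal translation, and the crossing produces an essential continuum through
    [p] on which [phi] is nearly constant. The images of these continua under the maps
    [g] are ordered from bottom to top by [d], and the height of a point with respect to
    them is a continuous [h] with [h (F z) = h z + rho], which descends to the factor
    map. *)
Require Import Defs.
From HB Require Import structures.
From mathcomp Require Import all_boot all_order all_algebra generic_quotient.
From mathcomp Require Import all_classical all_reals all_analysis.
From mathcomp Require Import zify ring lra.
Set Implicit Arguments.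
Unset Strict Implicit.
Unset Printing Implicit Defensive.
Import Order.TTheory GRing.Theory Num.Theory.
Import numFieldNormedType.Exports.
Local Open Scope classical_set_scope.
Local Open Scope ring_scope.

(** * Crossing continua in the plane *)

(** The supremum along orbits is equivariant but only lower semicontinuous, and continuity is
    obtained at a single point [p]. This is enough, because the maps [g] carry small continua
    through [p] to a dense set of levels: irrationality of [rho] makes [d] nonzero whenever [n] is,
    and recurrence at [p] makes it arbitrarily small. Irrationality also prevents a wandering
    component from returning to itself, so its iterates are distinct components and all but finitely
    many are small; a component then behaves asymptotically like one point. Avoiding the closures of
    all components forces the components near [p] to be small, and this is what turns continuity
    along the nonwandering set into continuity at [p] in the plane. Two-dimensional topology enters
    only through [continua_cross], proved by counting quarter turns on a finite grid. The sides of
    an essential continuum are defined by reachability of the two ends ([far]), so no Jordan curve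
    theorem is involved. *)

Section quadrants.
Variable R : realType.
Implicit Types u v w z : R * R.

Lemma pnorm_lt z (e : R) : (`|z| < e) = (`|z.1| < e) && (`|z.2| < e).
Proof. by rewrite prod_normE /= gt_max. Qed.

Lemma pnorm_le z (e : R) : (`|z| <= e) = (`|z.1| <= e) && (`|z.2| <= e).
Proof. by rewrite prod_normE /= ge_max. Qed.

(* The signed number of quarter turns from the quadrant of [u] to that of [v];
   junk (0) when the quadrants are opposite. *)
Definition quarter (a b c d : bool) : int :=
  match a, b, c, d with
  | false, false, true, false | true, false, true, true
  | true, true, false, true | false, true, false, false => 1
  | true, false, false, false | true, true, true, false
  | false, true, true, true | false, false, false, true => -1
  | _, _, _, _ => 0
  end.

Definition turn u v : int := quarter (u.1 < 0) (u.2 < 0) (v.1 < 0) (v.2 < 0).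

Definition nonopp u v := ((u.1 < 0) == (v.1 < 0)) || ((u.2 < 0) == (v.2 < 0)).

(** Any three quadrants contain an opposite pair, so pairwise non-opposite vectors occupy at most
    two adjacent quadrants and the turns cannot wrap around. *)
Lemma turnD u v w : nonopp u v -> nonopp v w -> nonopp u w ->
  turn u v + turn v w = turn u w.
Proof.
rewrite /nonopp /turn; by case: (u.1 < 0); case: (u.2 < 0); case: (v.1 < 0);
  case: (v.2 < 0); case: (w.1 < 0); case: (w.2 < 0).
Qed.

(** Opposite quadrants give [|u| <= |u - v|] in each coordinate, hence in the max norm. *)
Lemma nonopp_near (e : R) u v : 2 * e <= `|u| -> `|u - v| < 2 * e -> nonopp u v.
Proof.
move=> eu uv; rewrite /nonopp; apply: contraTT eu.
rewrite negb_or -ltNge pnorm_lt; move: uv; rewrite pnorm_lt /=.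
move=> /andP[]; rewrite !ltr_norml => /andP[h1 h2] /andP[h3 h4].
case: ltP => a; case: ltP => b; case: ltP => c; case: ltP => d //= _;
  apply/andP; split; apply/andP; split; lra.
Qed.

(** A discrete Stokes formula: the diagonal cuts each grid cell into two triangles, and [turnD] on
    both makes the sum around the cell vanish. The two inductions add up the cells. *)
Lemma quarter_winding (w : nat -> nat -> R * R) (m n : nat) :
  (forall i j, (i < m)%N -> (j < n)%N ->
    [/\ nonopp (w i j) (w i.+1 j), nonopp (w i j) (w i j.+1),
        nonopp (w i j) (w i.+1 j.+1), nonopp (w i.+1 j) (w i.+1 j.+1) &
        nonopp (w i j.+1) (w i.+1 j.+1)]) ->
  \sum_(i < m) turn (w i 0%N) (w i.+1 0%N) + \sum_(j < n) turn (w m j) (w m j.+1) =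
  \sum_(j < n) turn (w 0%N j) (w 0%N j.+1) + \sum_(i < m) turn (w i n) (w i.+1 n).
Proof.
elim: n => [|n IH] h; first by rewrite !big_ord0 addr0 add0r.
rewrite !big_ord_recr /= addrA IH => [|i j im jn]; last by apply: h => //; rewrite ltnS ltnW.
rewrite -!addrA; congr (_ + _).
elim: m h {IH} => [|m IH] h; first by rewrite !big_ord0 addr0 add0r.
rewrite !big_ord_recr /= addrA -IH => [|i j im jn]; last by apply: h => //; rewrite ltnS ltnW.
rewrite -!addrA; congr (_ + _).
by case: (h m n (ltnSn _) (ltnSn _)) => a b c d e; rewrite turnD // turnD.
Qed.

(** Meant for a side of the grid on which one coordinate keeps its sign: there the turn is the
    variation of a potential depending on the sign of the other coordinate. *)
Lemma turn_telescope (g : R * R -> int) (w : nat -> R * R) n :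
  (forall j, (j < n)%N -> turn (w j) (w j.+1) = g (w j.+1) - g (w j)) ->
  \sum_(j < n) turn (w j) (w j.+1) = g (w n) - g (w 0%N).
Proof.
move=> h; rewrite -(telescope_sumr (fun j => g (w j)) (leq0n n)) big_mkord.
by apply: eq_bigr => j _; rewrite h.
Qed.

(** The differences [p i - q j] stay away from [0], so they do not wind around it along the boundary
    of the grid; but the end conditions fix one sign on each of the four sides, which forces four
    quarter turns. *)
Lemma discrete_crossing (p q : nat -> R * R) (m n : nat) (e : R) :
  (forall i, (i < m)%N -> `|p i - p i.+1| < e) ->
  (forall j, (j < n)%N -> `|q j - q j.+1| < e) ->
  (forall i j, (i <= m)%N -> (j <= n)%N -> 2 * e <= `|p i - q j|) ->
  (forall j, (j <= n)%N -> (p 0%N).1 < (q j).1 < (p m).1) ->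
  (forall i, (i <= m)%N -> (q 0%N).2 < (p i).2 < (q n).2) -> False.
Proof.
move=> hp hq hpq hx hy.
pose w i j := p i - q j.
have e0 : (0 < m)%N -> (0 < n)%N -> 0 < e by move=> m0 _; apply: le_lt_trans (hp 0%N m0).
unshelve epose proof (@quarter_winding w m n _) as W.
  move=> i j im jn.
  have e1 := e0 (leq_ltn_trans (leq0n _) im) (leq_ltn_trans (leq0n _) jn).
  have a1 := hp _ im; have a2 := hq _ jn.
  have a3 : `|q j.+1 - q j| < e by rewrite distrC.
  have D (u v x y : R * R) : (u - x) - (v - y) = (u - v) + (y - x).
    by rewrite opprB addrACA [- x + _]addrC addrACA.
  (* On a diagonal step both chains move; hence the factor [2] in the distance hypothesis. *)
  have a4 := ler_normD (p i - p i.+1) (q j.+1 - q j).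
  by split; apply: (@nonopp_near e); rewrite ?hpq ?(ltnW im) ?(ltnW jn) // /w D
    ?subrr ?add0r ?addr0; lra.
move: W; pose b (x : R) : int := if x < 0 then 1 else 0.
have x0 j : (j <= n)%N -> (w 0%N j).1 < 0 by move=> /hx /andP[]; rewrite subr_lt0.
have xm j : (j <= n)%N -> ((w m j).1 < 0) = false.
  by move=> /hx /andP[_ h]; apply/negbTE; rewrite -leNgt subr_ge0 ltW.
have yn i : (i <= m)%N -> (w i n).2 < 0 by move=> /hy /andP[_]; rewrite subr_lt0.
have y0 i : (i <= m)%N -> ((w i 0%N).2 < 0) = false.
  by move=> /hy /andP[h _]; apply/negbTE; rewrite -leNgt subr_ge0 ltW.
rewrite (@turn_telescope (fun v => b v.1) (w ^~ 0%N)); last first.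
  by move=> i im; rewrite /turn /b !y0 ?(ltnW im) //; do 2!case: (_ < 0).
rewrite (@turn_telescope (fun v => - b v.2) (w m)); last first.
  by move=> j jn; rewrite /turn /b !xm ?(ltnW jn) //; do 2!case: (_ < 0).
rewrite (@turn_telescope (fun v => b v.2) (w 0%N)); last first.
  by move=> j jn; rewrite /turn /b !x0 ?(ltnW jn) //; do 2!case: (_ < 0).
rewrite (@turn_telescope (fun v => - b v.1) (w ^~ n)); last first.
  by move=> i im; rewrite /turn /b !yn ?(ltnW im) //; do 2!case: (_ < 0).
(* The two pairs of sides now read [-2 = 2]. *)
by rewrite /b !x0 // !xm // !yn // !y0.
Qed.

(** The points reachable from [a] by such chains form a set open and closed in [K]. *)
Lemma connected_chain (K : set (R * R)) (e : R) a b :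
  connected K -> 0 < e -> K a -> K b ->
  exists (p : nat -> R * R) (n : nat),
    [/\ p 0%N = a, p n = b, (forall i, (i <= n)%N -> K (p i)) &
        forall i, (i < n)%N -> `|p i - p i.+1| < e].
Proof.
move=> cK e0 Ka Kb.
pose B := [set b | exists (p : nat -> R * R) (n : nat),
    [/\ p 0%N = a, p n = b, (forall i, (i <= n)%N -> K (p i)) &
        forall i, (i < n)%N -> `|p i - p i.+1| < e]].
have Ba : B a by exists (fun=> a), 0%N; split.
have BK : B `<=` K by move=> x [p [n [_ <- h _]]]; exact: h.
have step x y : B x -> K y -> `|x - y| < e -> B y.
  move=> [p [n [p0 pn h1 h2]]] Ky xy.
  exists (fun i => if (i <= n)%N then p i else y), n.+1; split => //.
  - by rewrite ltnn.
  - by move=> i _; case: leqP => [/h1|].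
  - move=> i; rewrite ltnS => ni; rewrite ni; case: ltnP => [/h2//|nj].
    by have -> : i = n; [apply/eqP; rewrite eqn_leq ni|rewrite pn].
suff BE : B = K by rewrite -BE in Kb.
have openb (S : set (R * R)) : open (\bigcup_(x in S) ball x e).
  by apply: bigcup_open => x _; exact: ball_open.
apply: cK; first by exists a.
- exists (\bigcup_(x in B) ball x e); first exact: openb.
  apply/seteqP; split => [x Bx|x [Kx [y By]]].
    by split; [exact: BK|exists x => //; exact: ballxx].
  by rewrite -ball_normE => xy; exact: step xy.
- exists (~` \bigcup_(x in K `\` B) ball x e); first exact/open_closedC/openb.
  apply/seteqP; split => [x Bx|x [Kx nx]].
    split; [exact: BK|case=> y [Ky nBy]].
    by rewrite -ball_normE /= distrC => xy; apply: nBy; exact: step xy.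
  by apply: contrapT => nBx; apply: nx; exists x => //; exact: ballxx.
Qed.

Lemma compact_dist (K L : set (R * R)) : compact K -> closed L -> K `&` L = set0 ->
  exists2 e : R, 0 < e & forall u v, K u -> L v -> e <= `|u - v|.
Proof.
move=> /compact_near_coveringP cK cL KL.
unshelve epose proof (cK R (0^'+) (fun e u => forall v, L v -> e <= `|u - v|) _ _) as H.
  move=> u Ku.
  have : nbhs u (~` L).
    apply: open_nbhs_nbhs; split; first exact: closed_openC.
    by move=> Lu; rewrite -[False]/(set0 u) -KL.
  rewrite -nbhs_ballE => -[e /= e0 he].
  exists (ball u (e / 2), [set d | 0 < d < e / 2]) => /=.
    split; first by apply: nbhsx_ballx; rewrite divr_gt0.
    near=> d; apply/andP; split; near: d; [exact: nbhs_right_gt|].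
    by apply: nbhs_right_lt; rewrite divr_gt0.
  move=> [u' d] /= [uu' /andP[d0 de]] v Lv.
  rewrite leNgt; apply/negP => u'v; apply: (he v _ Lv).
  rewrite (splitr e); apply: ball_triangle uu' _.
  by rewrite -ball_normE; exact: lt_trans de.
have [e [e0 he]] : exists e : R, 0 < e /\ K `<=` (fun u => forall v, L v -> e <= `|u - v|).
  near (0 : R)^'+ => e; exists e; split; near: e; [exact: nbhs_right_gt|exact: H].
by exists e => // u v /he; exact.
Unshelve. all: by end_near. Qed.

(** Only chains matter, so connectedness suffices and nothing has to be parametrised. If the
    continua were [e] apart, chains of mesh [e / 2] would contradict [discrete_crossing]. *)
Theorem continua_cross (K L : set (R * R)) a b c d :
  compact K -> connected K -> compact L -> connected L ->
  K a -> K b -> L c -> L d ->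
  (forall v, L v -> a.1 < v.1 < b.1) -> (forall u, K u -> c.2 < u.2 < d.2) ->
  K `&` L !=set0.
Proof.
move=> kK cK kL cL Ka Kb Lc Ld hx hy; apply/set0P/negP => /eqP KL.
have clL : closed L by apply: compact_closed => //; exact: norm_hausdorff.
have [e e0 he] := compact_dist kK clL KL.
have e20 : 0 < e / 2 by rewrite divr_gt0.
have [p [m [p0 pm pK pe]]] := connected_chain cK e20 Ka Kb.
have [q [n [q0 qn qL qe]]] := connected_chain cL e20 Lc Ld.
apply: (@discrete_crossing p q m n (e / 2)) => // [i j im jn|j jn|i im].
- by rewrite mulrC divfK //; apply: he; [exact: pK|exact: qL].
- by rewrite p0 pm; apply/hx/qL.
- by rewrite q0 qn; apply/hy/pK.
Qed.

End quadrants.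

(** * Continua, segments and bounds in the plane *)

Section continua.
Variable R : realType.
Implicit Types (K A : set (R * R)) (x y z v : R * R).

Lemma pair_ext z v : z.1 = v.1 -> z.2 = v.2 -> z = v.
Proof. by case: z v => [a b] [c d] /= -> ->. Qed.

Definition continuum K := compact K /\ connected K.

Lemma continuumU K A z : K z -> A z -> continuum K -> continuum A ->
  continuum (K `|` A).
Proof.
move=> Kz Az [kK cK] [kA cA]; split; first exact: compactU.
by apply: connectedU => //; exists z.
Qed.

Lemma continuum_image (T : topologicalType) (K : set T) (g : T -> R * R) :
  continuous g -> compact K -> connected K -> continuum (g @` K).
Proof.
move=> cg kK cK; split.
  by apply: continuous_compact => //; exact: continuous_subspaceT.
by apply: connected_continuous_connected => //; exact: continuous_subspaceT.
Qed.

Lemma continuum_map K (g : R * R -> R * R) : continuous g -> continuum K ->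
  continuum (g @` K).
Proof. by move=> cg [kK cK]; exact: continuum_image. Qed.

Definition pseg x y : set (R * R) := [set x + t *: (y - x) | t in `[0, 1]%classic].

Lemma pseg_continuous x y : continuous (fun t : R => x + t *: (y - x)).
Proof.
move=> t; apply: cvgD; [exact: cvg_cst|].
by apply: cvgZ; [exact: cvg_id|exact: cvg_cst].
Qed.

Lemma continuum_pseg x y : continuum (pseg x y).
Proof.
apply: continuum_image; [exact: pseg_continuous|exact: segment_compact|].
exact: segment_connected.
Qed.

Lemma pseg_l x y : pseg x y x.
Proof. by exists 0; rewrite ?scale0r ?addr0 //= in_itv /= lexx ler01. Qed.

Lemma pseg_r x y : pseg x y y.
Proof. by exists 1; rewrite ?scale1r ?subrKC //= in_itv /= lexx ler01. Qed.

Lemma pseg_ball z (r : R) x y v : ball z r x -> ball z r y -> pseg x y v -> ball z r v.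
Proof.
rewrite -ball_normE /= => hx hy [t /=]; rewrite in_itv /= => /andP[t0 t1] <-.
have -> : z - (x + t *: (y - x)) = (1 - t) *: (z - x) + t *: (z - y).
  by apply: pair_ext => /=; rewrite /GRing.scale /=; ring.
apply: le_lt_trans (ler_normD _ _) _; rewrite !normrZ ger0_norm ?subr_ge0 // ger0_norm //.
have [->|tn] := eqVneq t 0; first by rewrite subr0 mul1r mul0r addr0.
have t00 : 0 < t by rewrite lt_def tn.
have : t * `|z - y| < t * r by rewrite ltr_pM2l.
have : (1 - t) * `|z - x| <= (1 - t) * r by rewrite ler_wpM2l ?subr_ge0 // ltW.
by move: (_ * `|z - x|) (_ * `|z - y|) => a b; lra.
Qed.

Lemma pseg_h (b c y : R) v : pseg (b, y) (c, y) v -> b <= c ->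
  v.2 = y /\ b <= v.1 <= c.
Proof.
move=> [t /=]; rewrite in_itv /= => /andP[t0 t1] <- bc /=.
rewrite /GRing.scale /= subrr mulr0 addr0; split => //; nra.
Qed.

Lemma compact_pbounded K : compact K ->
  exists2 B : R, 0 < B & forall z, K z -> `|z.1| < B /\ `|z.2| < B.
Proof.
move=> /compact_bounded [B [_ hB]].
exists (Num.max 1 (B + 1)); first by rewrite lt_max ltr01.
move=> z Kz; apply/andP; rewrite -pnorm_lt.
have := hB (B + 2^-1) _ z Kz; rewrite ltrDl invr_gt0 ltr0n => /(_ isT) h.
by apply: le_lt_trans h _; rewrite lt_max; apply/orP; right; lra.
Qed.

Lemma cvg_pairR (T : Type) (F : set_system T) {FF : Filter F} (f g : T -> R) (a b : R) :
  f x @[x --> F] --> a -> g x @[x --> F] --> b ->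
  ((f x, g x) : R * R) @[x --> F] --> ((a, b) : R * R).
Proof. by move=> fa gb; exact: (cvg_pair fa gb). Qed.

Lemma shift_continuous (v : R * R) : continuous (fun z => z + v).
Proof. by move=> z; apply: cvgD; [exact: cvg_id|exact: cvg_cst]. Qed.

End continua.

(** * Integer iterates with an explicit inverse *)

Section ziter.
Variables (T : Type) (g gi : T -> T).
Hypotheses (gK : cancel g gi) (giK : cancel gi g).

Definition ziter (h hi : T -> T) (n : int) : T -> T :=
  match n with Posz m => iter m h | Negz m => iter m.+1 hi end.

Lemma ziterS n z : ziter g gi (n + 1) z = g (ziter g gi n z).
Proof.
case: n => [m|m].
  by rewrite (_ : Posz m + 1 = Posz m.+1) //; lia.
case: m => [|m]; first by rewrite /= giK.
by rewrite (_ : Negz m.+1 + 1 = Negz m) /= ?giK //; lia.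
Qed.
End ziter.

Section ziter2.
Variables (T : Type) (g gi : T -> T).
Hypotheses (gK : cancel g gi) (giK : cancel gi g).
Local Notation zg := (ziter g gi).

Lemma ziterB n z : zg (n - 1) z = gi (zg n z).
Proof. by rewrite -[in RHS](subrK 1 n) ziterS // gK. Qed.

Lemma ziterD (i j : int) z : zg (i + j) z = zg i (zg j z).
Proof.
elim/int_rect: i => [|i IH|i IH]; first by rewrite add0r.
  rewrite (_ : i.+1%:Z + j = (i%:Z + j) + 1) ?ziterS //; last lia.
  by rewrite (_ : i.+1%:Z = i%:Z + 1) ?ziterS ?IH //; lia.
rewrite (_ : - i.+1%:Z + j = (- i%:Z + j) - 1) ?ziterB //; last lia.
by rewrite (_ : - i.+1%:Z = - i%:Z - 1) ?ziterB ?IH //; lia.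
Qed.

Lemma ziterK n : cancel (zg n) (zg (- n)).
Proof. by move=> z; rewrite -ziterD addNr. Qed.

Lemma ziterKN n : cancel (zg (- n)) (zg n).
Proof. by move=> z; rewrite -ziterD addrN. Qed.

End ziter2.

(** * Essential continua and the ends of the annulus *)

Section hulls.
Variable R : realType.
Local Notation P := (R * R)%type.
Implicit Types (K A B Gam : set P) (x y z v w : P) (s : R).

Definition hvec (l : int) : P := (l%:~R, 0).

Lemma hvecD l m : hvec (l + m) = hvec l + hvec m.
Proof. by apply: pair_ext; rewrite /= ?rmorphD //= addr0. Qed.

Lemma hvecN l : hvec (- l) = - hvec l.
Proof. by apply: pair_ext; rewrite /= ?rmorphN //= oppr0. Qed.

Lemma hvec0 : hvec 0 = 0. Proof. by []. Qed.

(* The preimage of the projection of [A] to the annulus. *)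
Definition hull A : set P := [set z | exists l, A (z + hvec l)].

Lemma sub_hull A : A `<=` hull A.
Proof. by move=> z Az; exists 0; rewrite hvec0 addr0. Qed.

Lemma hull_shift A z l : hull A z -> hull A (z + hvec l).
Proof. by move=> [m Am]; exists (m - l); rewrite hvecD hvecN -addrA [hvec l + _]addrC subrK. Qed.

Lemma hull_bounded A : compact A -> exists2 b : R, 0 < b & forall z, hull A z -> `|z.2| < b.
Proof.
move=> /compact_pbounded[b b0 hb]; exists b => // z [l /hb[_]] /=.
by rewrite addr0.
Qed.

Lemma closed_hull A : compact A -> closed (hull A).
Proof.
move=> kA; have [B B0 hB] := compact_pbounded kA.
have clA : closed A by apply: compact_closed => //; exact: norm_hausdorff.
move=> z clz; apply: contrapT => nz.
(* only finitely many translates of [A] come near [z] *)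
pose N := `|Num.floor (B + `|z.1| + 1)|%N.
have h (l : int) : \forall w \near z, ~ A (w + hvec l).
  apply: (@shift_continuous _ (hvec l) z (~` A)); apply: open_nbhs_nbhs; split.
    exact: closed_openC.
  by move=> ?; apply: nz; exists l.
have fin (m : nat) : \forall w \near z, forall l : int, (`|l| <= m)%N -> ~ A (w + hvec l).
  elim: m => [|m IH].
    by apply: filterS (h 0) => w hw l; rewrite leqn0 absz_eq0 => /eqP ->.
  apply: filterS3 IH (h m.+1) (h (- m.+1%:Z)) => w a b c l hl.
  have [lm|ml] := leqP `|l|%N m; first exact: a.
  have : (l = m.+1 \/ l = - m.+1%:Z) by lia.
  by case => ->.
have := clz _ (filterI (fin N) (nbhsx_ballx z 1 ltr01)).
case=> w [[l Al] [/(_ l) hw]]; rewrite -ball_normE /= pnorm_lt => /andP[/= w1 _].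
apply: (fun h => hw h Al).
have [/= Al1 _] := hB _ Al.
have : (`|l|%:~R : R) <= B + `|z.1| + 1.
  rewrite intr_norm; move: w1 Al1; rewrite !ltr_norml => /andP[a b] /andP[c d].
  rewrite ler_norml.
  have := ler_norm z.1; have := ler_norm (- z.1); rewrite normrN => e f.
  by apply/andP; split; lra.
by rewrite -floor_ge_int -abszE /N; move: (Num.Def.floor _) => m; lia.
Qed.

(* [far 1 Gam] (resp. [far (-1) Gam]) is the set of the points that can be
   joined to the upper (resp. lower) end of the plane without meeting [Gam]. *)
Definition far s Gam z := forall b : R, exists K, [/\ continuum K, K z,
  K `&` Gam = set0 & exists2 w, K w & b < s * w.2].

Definition unit_sign s := s = 1 \/ s = -1.

Lemma far_notin s Gam z : far s Gam z -> ~ Gam z.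
Proof.
by move=> /(_ 0)[K [_ Kz KG _]] Gz; rewrite -[False]/(set0 z) -KG.
Qed.

Lemma far_connect s Gam K x y : continuum K -> K `&` Gam = set0 -> K x -> K y ->
  far s Gam x -> far s Gam y.
Proof.
move=> cK KG Kx Ky fx b; have [L [cL Lx LG [w Lw bw]]] := fx b.
exists (K `|` L); split; [exact: continuumU Lx cK cL|by left| |by exists w; [right|]].
by rewrite setIUl KG LG setU0.
Qed.

Lemma far_shift s A z l : far s (hull A) z -> far s (hull A) (z + hvec l).
Proof.
move=> fz b; have [K [cK Kz KG [w Kw bw]]] := fz b.
exists ((fun z => z + hvec l) @` K); split.
- by apply: continuum_map => //; exact: shift_continuous.
- by exists z.
- rewrite -subset0 => y [[x Kx <-]] /(hull_shift (- l)); rewrite hvecN addrK => hx.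
  by have : set0 x by rewrite -KG.
- by exists (w + hvec l); [exists w|rewrite /= addr0].
Qed.

(** The witness is a vertical segment starting at [z]; the sign [s] treats both ends at once. *)
Lemma far_vertical s Gam z : unit_sign s ->
  (forall v, Gam v -> v.1 = z.1 -> s * v.2 < s * z.2) -> far s Gam z.
Proof.
move=> us h b.
pose y : R := s * Num.max (b + 1) (s * z.2).
have ss : s * s = 1 by case: us => ->; rewrite ?mulrNN mulr1.
exists (pseg z (z.1, y)); split.
- exact: continuum_pseg.
- exact: pseg_l.
- rewrite -subset0 => v [[t /=]]; rewrite in_itv /= => /andP[t0 t1] <- /h /=.
  rewrite /GRing.scale /= subrr mulr0 addr0 => /(_ erefl).
  rewrite ltNge => /negP; apply.
  rewrite mulrDr lerDl mulrCA mulr_ge0 // mulrBr /y mulrA ss mul1r subr_ge0.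
  by rewrite le_max lexx orbT.
- exists (z.1, y); first exact: pseg_r.
  by rewrite /= /y mulrA ss mul1r lt_max; apply/orP; left; lra.
Qed.

(** Off the closed hull, segments in a small ball miss the hull, so [far] is locally constant there;
    [notfar_nbhs] is the other half. *)
Lemma far_nbhs s A z : compact A -> far s (hull A) z -> \forall w \near z, far s (hull A) w.
Proof.
move=> kA fz.
have : nbhs z (~` hull A).
  apply: open_nbhs_nbhs; split; first exact/closed_openC/closed_hull.
  exact: far_notin fz.
rewrite -nbhs_ballE => -[e /= e0 he].
apply: (@filterS _ _ _ (ball z e)); last exact: nbhsx_ballx.
move=> w zw; apply: (@far_connect _ _ (pseg z w) z w) => //.
- exact: continuum_pseg.
- rewrite -subset0 => v [vz]; apply: he; apply: pseg_ball vz => //.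
  exact: ballxx.
- exact: pseg_l.
- exact: pseg_r.
Qed.

Lemma notfar_nbhs s A z : compact A -> ~ hull A z -> ~ far s (hull A) z ->
  \forall w \near z, ~ far s (hull A) w.
Proof.
move=> kA nz fz.
have : nbhs z (~` hull A).
  by apply: open_nbhs_nbhs; split; first exact/closed_openC/closed_hull.
rewrite -nbhs_ballE => -[e /= e0 he].
apply: (@filterS _ _ _ (ball z e)); last exact: nbhsx_ballx.
move=> w zw fw; apply: fz; apply: (@far_connect _ _ (pseg z w) w z) => //.
- exact: continuum_pseg.
- rewrite -subset0 => v [vz]; apply: he; apply: pseg_ball vz => //.
  exact: ballxx.
- exact: pseg_r.
- exact: pseg_l.
Qed.

(* Continua whose projection to the annulus contains an essential loop. *)
Definition essential A := continuum A /\
  exists a (l : int), [/\ l != 0, A a & A (a + hvec l)].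

Lemma essential_pos A : essential A ->
  exists a (l : int), [/\ 0 < l, A a & A (a + hvec l)].
Proof.
move=> [cA [a [l [l0 Aa Al]]]].
have [lp|lp|l0'] := ltgtP l 0; last by rewrite l0' eqxx in l0.
  exists (a + hvec l), (- l); split=> //; first by lia.
  by rewrite hvecN addrK.
by exists a, l.
Qed.

Fixpoint chain (S : int -> set P) (a : int) (m : nat) : set P :=
  if m is m'.+1 then chain S a m' `|` S (a + m%:Z) else S a.

Lemma chainP S a m z : chain S a m z <-> exists2 i : nat, (i <= m)%N & S (a + i%:Z) z.
Proof.
elim: m => [|m IH] /=.
  split => [Sz|[i]]; first by exists 0%N => //; rewrite addr0.
  by rewrite leqn0 => /eqP ->; rewrite addr0.
split=> [[/IH[i im Sz]|Sz]|[i]].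
- by exists i => //; exact: leqW.
- by exists m.+1.
- rewrite leq_eqVlt => /orP[/eqP ->|]; first by right.
  by rewrite ltnS => im Sz; left; apply/IH; exists i.
Qed.

Lemma continuum_chain S a m (x : int -> P) : (forall i, continuum (S i)) ->
  (forall i, S i (x i) /\ S i (x (i + 1))) -> continuum (chain S a m).
Proof.
move=> cS hx; elim: m => [|m IH] //=.
apply: (@continuumU _ _ _ (x (a + m.+1%:Z))) => //; last exact: (hx _).1.
apply/chainP; exists m => //; rewrite (_ : a + m.+1%:Z = a + m%:Z + 1); last by lia.
exact: (hx _).2.
Qed.

(** A point joined to both ends yields a continuum running from below [A] to above it. Enough
    consecutive translates of [A] form a continuum running from left to right, and the two must
    cross. *)
Lemma far_disjoint A z : essential A -> far 1 (hull A) z -> far (-1) (hull A) z -> False.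
Proof.
move=> eA f1 f2; have [kA cA] := eA.1.
have [B B0 hB] := compact_pbounded kA.
have [K1 [cK1 K1z K1A [w1 K1w w1B]]] := f1 B.
have [K2 [cK2 K2z K2A [w2 K2w w2B]]] := f2 B.
have [kK cK] := continuumU K1z K2z cK1 cK2.
have [X X0 hX] := compact_pbounded kK.
have [a [l [l0 Aa Al]]] := essential_pos eA.
pose S (i : int) := (fun z => z + hvec (i * l)) @` A.
pose J := Num.bound (X + B).
have lt_J (x : R) : - B < x < B -> x + J%:R > X /\ x - J%:R < - X.
  have : X + B < J%:R by apply: archi_boundP; lra.
  by move=> h /andP[h1 h2]; split; lra.
have lJ : (J%:Z%:~R : R) <= (J%:Z * l)%:~R by rewrite ler_int; nia.
have cS m : continuum (chain S (- J%:Z) m).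
  apply: (@continuum_chain _ _ _ (fun i => a + hvec (i * l))) => i.
    by apply: continuum_map; [exact: shift_continuous|split].
  split; [by exists a|exists (a + hvec l) => //].
  by rewrite -addrA -hvecD; congr (_ + hvec _); lia.
have [kS cS'] := cS (J + J)%N.
have Sl : chain S (- J%:Z) (J + J) (a + hvec (- J%:Z * l)).
  by apply/chainP; exists 0%N => //; rewrite addr0; exists a.
have Sr : chain S (- J%:Z) (J + J) (a + hvec (J%:Z * l)).
  by apply/chainP; exists (J + J)%N => //; exists a => //; congr (_ + hvec _); lia.
have [] := continua_cross kS cS' kK cK Sl Sr (or_intror K2w) (or_introl K1w).
- move=> v /hX[]; have [] := hB _ Aa; rewrite !ltr_norml => /andP[h1 h2] _ /andP[h3 h4] _.
  have [|h5 h6] := lt_J a.1; first by rewrite h1.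
  by rewrite /= mulNr rmorphN /=; apply/andP; split; lra.
- move=> u /chainP[i _ [v Av <-]] /=; rewrite addr0.
  have [_] := hB _ Av; rewrite ltr_norml => /andP[h1 h2].
  by apply/andP; split; lra.
move=> z0 [/chainP[i _ [v Av vz]] z0K].
have hz : hull A z0 by exists (- ((- J%:Z + i%:Z) * l)); rewrite -vz hvecN addrK.
by case: z0K => Kz; [have : set0 z0 by rewrite -K1A|have : set0 z0 by rewrite -K2A].
Qed.

End hulls.

(** * The vertical order of disjoint essential continua *)

Section ordering.
Variable R : realType.
Local Notation P := (R * R)%type.
Implicit Types (K A B Gam : set P) (x y z v w : P).

Lemma hull_disjoint_sym A B : hull A `&` hull B = set0 -> hull B `&` hull A = set0.
Proof. by rewrite setIC. Qed.

(** Moving inside [A] never meets [hull B], so one far point, taken up to horizontal translation,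
    decides for all of [A]. *)
Lemma far_spread (s : R) A B x : continuum A -> hull A `&` hull B = set0 ->
  hull A x -> far s (hull B) x -> forall y, A y -> far s (hull B) y.
Proof.
move=> cA AB [l Al] fx y Ay.
apply: (far_connect cA _ Al Ay); last exact: far_shift.
by rewrite -subset0 => z [/sub_hull Az Bz]; have : set0 z by rewrite -AB.
Qed.

(** On the vertical line through a point of [A], the extreme point of the two hulls in the direction
    [s] belongs to one of them, and the other has nothing beyond it. *)
Lemma far_alternative (s : R) A B : unit_sign s -> continuum A -> continuum B ->
  A !=set0 -> hull A `&` hull B = set0 ->
  (forall z, A z -> far s (hull B) z) \/ (forall z, B z -> far s (hull A) z).
Proof.
move=> us cA cB [a Aa] AB.
have ss : s * s = 1 by case: us => ->; rewrite ?mulrNN mulr1.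
pose T := [set t : R | (hull A `|` hull B) (a.1, s * t)].
have T0 : T (s * a.2) by left; rewrite mulrA ss mul1r; case: (a) Aa => ? ? /sub_hull.
have [b1 b10 hb1] := hull_bounded cA.1; have [b2 b20 hb2] := hull_bounded cB.1.
have sn (t : R) : `|s * t| = `|t| by rewrite normrM; case: us => ->; rewrite ?normrN normr1 mul1r.
have Tsup : has_sup T.
  split; first by exists (s * a.2).
  exists (Num.max b1 b2) => t [/hb1|/hb2] /=; rewrite sn le_max => h.
    by rewrite (le_trans (ler_norm _)) // ltW.
  by apply/orP; right; rewrite (le_trans (ler_norm _)) // ltW.
have clT : closed T.
  have : closed (hull A `|` hull B) by apply: closedU; apply: closed_hull; [exact: cA.1|exact: cB.1].
  have /continuous_closedP cl : continuous (fun t : R => (a.1, s * t) : P).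
    move=> t; apply: cvg_pairR; first exact: cvg_cst.
    by apply: cvgM; [exact: cvg_cst|exact: cvg_id].
  exact: cl.
have Ts : T (sup T) by by apply: clT; case: Tsup; exact: closure_sup.
have up v : (hull A `|` hull B) v -> v.1 = a.1 -> s * v.2 <= sup T.
  move=> hv va; apply: sup_upper_bound => //=.
  by rewrite /T /= mulrA ss mul1r -va; case: v hv {va}.
case: (Ts) => hT; [left; apply: (far_spread cA AB hT)
                  |right; apply: (far_spread cB (hull_disjoint_sym AB) hT)].
- apply: far_vertical => // v Bv /= va; rewrite mulrA ss mul1r lt_neqAle up ?andbT //; last by right.
  apply/eqP => h; have : set0 v; last by [].
  rewrite -AB; split => //; move: hT; rewrite -h mulrA ss mul1r -va.
  by case: v {Bv va h}.
- apply: far_vertical => // v Av /= va; rewrite mulrA ss mul1r lt_neqAle up ?andbT //; last by left.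
  apply/eqP => h; have : set0 v; last by [].
  rewrite -AB; split => //; move: hT; rewrite -h mulrA ss mul1r -va.
  by case: v {Av va h}.
Qed.

(** If [z] cannot escape past [B], a continuum along which it escapes from [A] must hit [hull B],
    and the point hit is on the far side of [A]. *)
Lemma far_mono (s : R) A B z : continuum B -> hull A `&` hull B = set0 ->
  far s (hull A) z -> far s (hull B) z \/ (forall y, B y -> far s (hull A) y).
Proof.
move=> cB AB fz; have [|nf] := pselect (far s (hull B) z); [by left|right].
have [b hb] : exists b : R, forall K, continuum K -> K z -> K `&` hull A = set0 ->
    (exists2 w, K w & b < s * w.2) -> K `&` hull B !=set0.
  apply: contrapT => /forallNP nb; apply: nf => b.
  have /existsNP[K] := nb b; move=> /not_implyP[cK] /not_implyP[Kz] /not_implyP[KA].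
  move=> /not_implyP[Kw /set0P/negP]; rewrite negbK => /eqP KB.
  by exists K; split.
have [K [cK Kz KA Kw]] := fz b.
have [y [Ky By]] := hb K cK Kz KA Kw.
apply: (far_spread cB _ By); first by rewrite setIC.
exact: far_connect cK KA Kz Ky fz.
Qed.

Definition below A B := (forall z, A z -> far (-1) (hull B) z) /\
  (forall z, B z -> far 1 (hull A) z).

(** The alternatives for the two ends give four cases; in two of them a point would be far from the
    same continuum at both ends. *)
Lemma below_total A B : essential A -> essential B -> hull A `&` hull B = set0 ->
  below A B \/ below B A.
Proof.
move=> eA eB AB.
have [a [_ [_ Aa _]]] := eA.2; have [b [_ [_ Bb _]]] := eB.2.
have A0 : A !=set0 by exists a.
have := far_alternative (or_introl erefl) eA.1 eB.1 A0 AB.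
have := far_alternative (or_intror erefl) eA.1 eB.1 A0 AB.
case=> h1 [] h2.
- by case: (far_disjoint eB (h2 _ Aa) (h1 _ Aa)).
- by left.
- by right.
- by case: (far_disjoint eA (h2 _ Bb) (h1 _ Bb)).
Qed.

Lemma below_far A B z : essential A -> essential B -> hull A `&` hull B = set0 ->
  below A B -> far (-1) (hull A) z -> far (-1) (hull B) z.
Proof.
move=> eA eB AB [_ h2] fz; have [b [_ [_ Bb _]]] := eB.2.
have [//|h] := far_mono eB.1 AB fz.
by case: (far_disjoint eA (h2 _ Bb) (h _ Bb)).
Qed.

End ordering.

(** * The height function *)

Section height.
Variable R : realType.
Local Notation P := (R * R)%type.
Implicit Types (K A B Gam : set P) (x y z v w : P) (g : P -> P) (d e : R) (n : int).

(* [G g n d] reads: [g] is the composition of the [n]-th iterate of the lift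
   with an integer translation, and [d] is its asymptotic vertical displacement. *)
Variables (k : int) (G : (P -> P) -> int -> R -> Prop) (C : R).
(** All that the planar argument needs from the lifts. The twist enters only through [tg_vert],
    whose shear grows with [n], and the constant [C] of [tg_dev] is common to the whole group. *)
Record twist_group : Prop := TwistGroup {
  tg_comp : forall g n d g' n' d', G g n d -> G g' n' d' ->
    G (g \o g') (n + n') (d + d');
  tg_inv : forall g n d, G g n d ->
    exists gi, [/\ G gi (- n) (- d), cancel g gi & cancel gi g];
  tg_cont : forall g n d, G g n d -> continuous g;
  tg_hvec : forall g n d z l, G g n d -> g (z + hvec R l) = g z + hvec R l;
  tg_vert : forall g n d z, G g n d -> g (z + (0, 1)) = g z + ((n * k)%:~R, 1);
  tg_dev : forall g n d z, G g n d -> `|(g z).2 - z.2 - d| <= C;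
  tg_shift : forall l m : int, G (fun z => z + (l%:~R, m%:~R)) 0 m%:~R }.
Hypothesis tG : twist_group.

Lemma tg_id : exists2 g, G g 0 0 & forall z, g z = z.
Proof.
by exists (fun z => z + (0%:~R, 0%:~R)) => [|z]; [exact: tg_shift|rewrite addr0].
Qed.

Lemma tg_iter g gi n d j : G g n d -> cancel g gi -> cancel gi g ->
  G (ziter g gi j) (j * n) (j%:~R * d).
Proof.
move=> Gg gK giK.
have [gi' [Ggi' gK' giK']] := tg_inv tG Gg.
have gE : gi' = gi by apply/funext => z; rewrite -[z in LHS]giK gK'.
have {}Ggi' : G gi (- n) (- d) by rewrite -gE.
have [i0 Gi0 i0E] := tg_id.
have {i0E}Gi0 : G id 0 0 by rewrite (_ : id = i0) //; apply/funext => z; rewrite i0E.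
elim/int_rect: j => [|j IH|j IH]; first by rewrite !mul0r.
- rewrite (_ : ziter _ _ _ = g \o ziter g gi j) //.
  rewrite (_ : j.+1%:Z * n = n + j%:Z * n); last lia.
  by rewrite (_ : j.+1%:Z%:~R * d = d + j%:Z%:~R * d) ?intS ?rmorphD ?mulrDl ?mul1r //; apply: tg_comp.
- rewrite (_ : ziter _ _ _ = gi \o ziter g gi (- j%:Z)); last first.
    apply/funext => z; rewrite (_ : - j.+1%:Z = - j%:Z - 1) ?ziterB //; lia.
  rewrite (_ : - j.+1%:Z * n = - n + - j%:Z * n); last lia.
  rewrite (_ : (- j.+1%:Z)%:~R * d = - d + (- j%:Z)%:~R * d); first exact: tg_comp.
  by rewrite intS !rmorphN rmorphD /= mulNr mulrDl mul1r opprD mulNr.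
Qed.

Lemma hull_map g n d A : G g n d -> hull (g @` A) = g @` (hull A).
Proof.
move=> Gg; have [gi [Ggi gK giK]] := tg_inv tG Gg.
apply/seteqP; split=> [z [l [x Ax xz]]|_ [x [l Ax] <-]].
  exists (x + hvec R (- l)); last by rewrite (tg_hvec tG _ _ Gg) xz hvecN addrK.
  by exists l; rewrite hvecN subrK.
by exists l; exists (x + hvec R l) => //; rewrite (tg_hvec tG _ _ Gg).
Qed.

(** Heights change by [d] up to the error [C], so [g] preserves the two ends. *)
Lemma far_map g n d (s : R) Gam z : G g n d -> unit_sign s ->
  far s Gam z -> far s (g @` Gam) (g z).
Proof.
move=> Gg us fz b; have [gi [Ggi gK giK]] := tg_inv tG Gg.
have [K [cK Kz KG [w Kw bw]]] := fz (b + C - s * d).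
exists (g @` K); split.
- by apply: continuum_map => //; exact: tg_cont Gg.
- by exists z.
- rewrite -subset0 => _ [[x Kx <-]] [y Gy /(can_inj gK) yx].
  rewrite yx in Gy. by have : set0 x by rewrite -KG.
- exists (g w); first by exists w.
  have := tg_dev tG w Gg; rewrite ler_norml => /andP[h1 h2].
  by case: us bw => ->; lra.
Qed.

Lemma continuum_tg g n d A : G g n d -> continuum A -> continuum (g @` A).
Proof. by move=> Gg; apply: continuum_map; exact: tg_cont Gg. Qed.

Lemma essential_map g n d A : G g n d -> essential A -> essential (g @` A).
Proof.
move=> Gg [cA [a [l [l0 Aa Al]]]]; split; first exact: continuum_tg Gg cA.
exists (g a), l; split=> //.
by exists (a + hvec R l) => //; rewrite (tg_hvec tG _ _ Gg).
Qed.

Variable phi : P -> R.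
Hypothesis phiG : forall g n d z, G g n d -> phi (g z) = phi z + d.

Lemma phi_hvec z l : phi (z + hvec R l) = phi z.
Proof. by rewrite (phiG z (tg_shift tG l 0)) addr0. Qed.

Lemma hull_disjoint_phi A B : (forall z w, A z -> B w -> phi z != phi w) ->
  hull A `&` hull B = set0.
Proof.
move=> h; rewrite -subset0 => z [[l Al] [m Bm]].
by have := h _ _ Al Bm; rewrite !phi_hvec eqxx.
Qed.

(** An oscillation smaller than [d] makes [A] and its image disjoint. If the image were the lower
    one, being below any forward image of [A] would imply being below [A]; but the displacement
    [J * d] lifts the [J]-th image above the point [a] of [A]. *)
Lemma below_dynamic g n d A e : G g n d -> essential A ->
  (forall z w, A z -> A w -> phi z - phi w <= e) -> e < d -> below A (g @` A).
Proof.
move=> Gg eA hA ed; have [gi [Ggi gK giK]] := tg_inv tG Gg.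
have [a [_ [_ Aa _]]] := eA.2.
have e0 : 0 <= e by have := hA _ _ Aa Aa; rewrite subrr.
have dis : hull A `&` hull (g @` A) = set0.
  apply: hull_disjoint_phi => z _ Az [w Aw <-]; rewrite (phiG _ Gg).
  by have := hA _ _ Az Aw; case: eqP => // ->; lra.
have egA := essential_map Gg eA.
have [//|gb] := below_total eA egA dis.
pose gz j := ziter g gi j.
have desc (j : nat) z : far (-1) (hull (gz j @` A)) z -> far (-1) (hull A) z.
  elim: j z => [|j IH] z; first by rewrite /gz /= image_id.
  move=> fz; apply: IH.
  have Gj := tg_iter j Gg gK giK.
  have [gj [Ggj gjK gjiK]] := tg_inv tG Gj.
  rewrite -[z]gjiK (hull_map _ Gj); apply: far_map Gj _ _; first by right.
  apply: (below_far egA eA _ gb); first by rewrite setIC.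
  rewrite (hull_map _ Gg).
  have -> : g @` hull A = gj @` (gz j.+1 @` hull A).
    rewrite image_comp; congr (_ @` _); apply/funext => x /=.
    rewrite -[g x]gjK; congr (gj _).
    by rewrite /gz /= -iterSr.
  have Gj1 := tg_iter j.+1 Gg gK giK.
  by rewrite -(hull_map _ Gj1); apply: far_map Ggj _ fz; right.
exfalso.
have [b b0 hb] := hull_bounded eA.1.1.
pose J := Num.bound ((b + C + `|a.2|) / d).
have Jd : b + C + `|a.2| < J%:R * d.
  rewrite -ltr_pdivrMr; last by lra.
  apply: archi_boundP; apply: divr_ge0; last by lra.
  have := tg_dev tG a Gg; have := normr_ge0 ((g a).2 - a.2 - d).
  by have := normr_ge0 a.2; lra.
have Gj := tg_iter J Gg gK giK.
suff : far (-1) (hull (gz J @` A)) a by move/desc/far_notin; apply; exact: sub_hull.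
apply: far_vertical; first by right.
rewrite (hull_map _ Gj) => _ [v hv <-] _.
have := tg_dev tG v Gj; have := hb _ hv; rewrite ltr_norml ler_norml.
move=> /andP[h1 h2] /andP[h3 h4]; have := ler_norm a.2.
by rewrite -pmulrn in h3 h4; lra.
Qed.


Definition small_at (p : P) e A := [/\ essential A, A p &
  forall z, A z -> `|phi z - phi p| <= e].

Lemma small_osc p e A z w : small_at p e A -> A z -> A w -> phi z - phi w <= 2 * e.
Proof.
move=> [_ _ h] /h; rewrite ler_norml => /andP[h1 h2] /h.
by rewrite ler_norml => /andP[h3 h4]; lra.
Qed.

(** [below_dynamic] compares images of one continuum only. Here the images of [A] and [A1] under [g]
    share the point [g p], and the position of this point relative to the image of [A1] under [g1]
    excludes the wrong order. *)
Lemma below_small p g n d e A g1 n1 d1 e1 A1 :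
  G g n d -> small_at p e A -> G g1 n1 d1 -> small_at p e1 A1 ->
  2 * e < d1 - d -> 2 * e1 < d1 - d ->
  hull (g @` A) `&` hull (g1 @` A1) = set0 /\ below (g @` A) (g1 @` A1).
Proof.
move=> Gg sA Gg1 sA1 ed ed1.
have [eA Ap hA] := sA; have [eA1 A1p hA1] := sA1.
have [gi [Ggi gK giK]] := tg_inv tG Gg.
have Gh : G (g1 \o gi) (n1 + - n) (d1 - d) by exact: tg_comp.
have dis : hull (g @` A) `&` hull (g1 @` A1) = set0.
  apply: hull_disjoint_phi => _ _ [z Az <-] [w Aw <-].
  rewrite (phiG _ Gg) (phiG _ Gg1).
  have := hA _ Az; have := hA1 _ Aw; rewrite !ler_norml => /andP[h1 h2] /andP[h3 h4].
  by apply/eqP => h; lra.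
split=> //.
have egA := essential_map Gg eA; have eg1A1 := essential_map Gg1 eA1.
have [//|bad] := below_total egA eg1A1 dis.
have egA1 := essential_map Gg eA1.
have [b1 _] : below (g @` A1) ((g1 \o gi) @` (g @` A1)).
  apply: (below_dynamic Gh egA1 _ ed1) => _ _ [z Az <-] [w Aw <-].
  by rewrite !(phiG _ Gg); have := small_osc sA1 Az Aw; lra.
have /b1 f1 : (g @` A1) (g p) by exists p.
have /bad.2 f2 : (g @` A) (g p) by exists p.
exfalso; apply: (far_disjoint eg1A1 f2).
suff <- : (g1 \o gi) @` (g @` A1) = g1 @` A1 by [].
by rewrite image_comp; congr (_ @` _); apply/funext => x /=; rewrite gK.
Qed.

Variables (p : P) (C' : R).
Hypothesis phi_y : forall z, `|phi z - z.2| <= C'.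
Hypothesis small_ex : forall e, 0 < e -> exists A, small_at p e A.
Hypothesis small_d : forall e, 0 < e -> exists g n d, G g n d /\ 0 < `|d| < e.

Lemma tg_dense (a b : R) : a < b -> exists g n d, G g n d /\ a < d < b.
Proof.
move=> ab; have [|g [n [d [Gg /andP[d0 de]]]]] := small_d (e := b - a); first by lra.
have [g1 [n1 [d1 [Gg1 d10 d1e]]]] : exists g n d, [/\ G g n d, 0 < d & d < b - a].
  have [dp|dn] := ltP 0 d; first by exists g, n, d; split => //; rewrite -(gtr0_norm dp).
  have [gi [Ggi _ _]] := tg_inv tG Gg; exists gi, (- n), (- d).
  by move: d0 de; rewrite ler0_norm.
have [gi [Ggi gK giK]] := tg_inv tG Gg1.
pose j := Num.floor (a / d1) + 1.
exists (ziter g1 gi j), (j * n1), (j%:~R * d1); split; first exact: tg_iter.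
have := floor_itv (a / d1); rewrite -/j => /andP[].
rewrite ler_pdivlMr // ltr_pdivrMr // => h1 h2; rewrite h2 /=.
by move: h1; rewrite /j rmorphD /= mulrDl mul1r; lra.
Qed.

(** Levels of essential continua that have [z] below them. The term [3 * e] charges for the
    oscillation of the continuum, so that a difference of values guarantees the gap above [2 * e]
    required by [below_small]. *)
Definition heights z := [set t | exists g n d e A,
  [/\ G g n d, small_at p e A, far (-1) (hull (g @` A)) z & t = d + 3 * e]].

Definition height z := inf (heights z).

Lemma small_hull_height g n d e A z : G g n d -> small_at p e A -> hull (g @` A) z ->
  `|z.2 - d - phi p| <= e + C'.
Proof.
move=> Gg [_ _ hA] [l [w Aw wz]].
have := phi_y z; rewrite -(phi_hvec z l) -wz (phiG _ Gg).
have := hA _ Aw; rewrite !ler_norml => /andP[h1 h2] /andP[h3 h4].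
by apply/andP; split; lra.
Qed.

Lemma small_ge0 e A : small_at p e A -> 0 <= e.
Proof. by move=> [_ Ap hA]; apply: le_trans (hA _ Ap). Qed.

Lemma heights_inf z : has_inf (heights z).
Proof.
split.
  have [A sA] := small_ex (@ltr01 R).
  pose m : int := Num.floor (z.2 + 1 + C' - phi p) + 1.
  have Gm := tg_shift tG 0 m.
  exists (m%:~R + 3 * 1), (fun z => z + (0%:~R, m%:~R)), 0, m%:~R, 1, A; split=> //.
  apply: far_vertical; first by right.
  move=> v /(small_hull_height Gm sA); rewrite ler_norml => /andP[h1 h2] _.
  have /andP[_] := floor_itv (z.2 + 1 + C' - phi p); rewrite -/m => h.
  by lra.
exists (z.2 - phi p - C') => _ [g [n [d [e [A [Gg sA fz ->]]]]]].
have e0 := small_ge0 sA.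
rewrite leNgt; apply/negP => h.
have eA := essential_map Gg (let: And3 a _ _ := sA in a).
apply: (far_disjoint eA _ fz); apply: far_vertical; first by left.
move=> v /(small_hull_height Gg sA); rewrite ler_norml => /andP[h1 h2] _.
by rewrite !mul1r; lra.
Qed.

Lemma height_ltP z t : height z < t -> exists g n d e A,
  [/\ G g n d, small_at p e A, far (-1) (hull (g @` A)) z & d + 3 * e < t].
Proof.
move=> /(inf_lt (heights_inf z).1)[_ [g [n [d [e [A [Gg sA fz ->]]]]]]] lt.
by exists g, n, d, e, A.
Qed.

Lemma height_le z g n d e A : G g n d -> small_at p e A ->
  far (-1) (hull (g @` A)) z -> height z <= d + 3 * e.
Proof.
move=> Gg sA fz; apply: ge_inf; first exact: (heights_inf z).2.
by exists g, n, d, e, A.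
Qed.

Lemma heightG g n d z : G g n d -> height (g z) = height z + d.
Proof.
have le g1 n1 d1 z1 : G g1 n1 d1 -> height (g1 z1) <= height z1 + d1.
  move=> Gg; rewrite leNgt; apply/negP; rewrite -ltrBrDr.
  move=> /height_ltP[g' [n' [d' [e [A [Gg' sA fz lt]]]]]].
  have Gh := tg_comp tG Gg Gg'.
  have := @height_le (g1 z1) _ _ _ e A Gh sA.
  have -> : (g1 \o g') @` A = g1 @` (g' @` A) by rewrite image_comp.
  rewrite (hull_map _ Gg) => /(_ (far_map Gg (or_intror erefl) fz)); lra.
move=> Gg; apply/eqP; rewrite eq_le (le _ _ _ _ Gg) /=.
have [gi [Ggi gK giK]] := tg_inv tG Gg.
by have := le _ _ _ (g z) Ggi; rewrite gK; lra.
Qed.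

(** Being below a given continuum is an open condition, whence the upper bound. For the lower bound,
    some continuum of level slightly under [height z] has neither [z] nor the nearby points below
    it, while every continuum of still smaller value lies below that one. *)
Lemma height_continuous : continuous height.
Proof.
move=> z; apply/cvgrPdist_lt => e e0.
have up : \forall w \near z, height w < height z + e.
  have /height_ltP[g [n [d [e' [A [Gg sA fz lt]]]]]] : height z < height z + e by lra.
  have kA : compact (g @` A) by have [[cA _] _ _] := sA; case: (continuum_tg Gg cA).
  apply: filterS (far_nbhs kA fz) => w fw.
  exact: le_lt_trans (height_le Gg sA fw) lt.
have low : \forall w \near z, height z - e < height w.
  pose t := height z - e / 2; pose eta := e / 32.
  have eta0 : 0 < eta by rewrite divr_gt0.
  have [A sA] := small_ex eta0.
  have [|g [n [d [Gg /andP[d1 d2]]]]] := @tg_dense (t + 3 * eta) (t + 4 * eta).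
    by lra.
  (* A second level, still too low to have [z] below it, keeps [z] off the hull of the first one, as
     [notfar_nbhs] requires. *)
  have [|g1 [n1 [d' [Gg1 /andP[d3 d4]]]]] := @tg_dense (t + 7 * eta) (t + 8 * eta).
    by lra.
  have nz1 : ~ far (-1) (hull (g1 @` A)) z.
    by move=> /(height_le Gg1 sA); rewrite /t /eta in d4 *; lra.
  have [||dis bel] := below_small Gg sA Gg1 sA; [lra|lra|].
  have [eA _ _] := sA.
  have egA := essential_map Gg eA; have eg1A := essential_map Gg1 eA.
  have nz : ~ far (-1) (hull (g @` A)) z by move=> /(below_far egA eg1A dis bel).
  have nh : ~ hull (g @` A) z.
    move=> [l Al]; apply: nz1.
    by rewrite -[z](addrK (hvec R l)) -hvecN; apply: far_shift; apply: bel.1.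
  apply: filterS (notfar_nbhs egA.1.1 nh nz) => w nw.
  rewrite ltNge; apply/negP => hw.
  have /height_ltP[g' [n' [d5 [e' [A' [Gg' sA' fw lt]]]]]] : height w < t + eta.
    by rewrite /t /eta; lra.
  have e'0 := small_ge0 sA'.
  (* The charge [3 * e'] gives [d - d5 > 2 * eta + 3 * e'], enough for both gap conditions. *)
  apply: nw; have [||dis' bel'] := below_small Gg' sA' Gg sA; [lra|lra|].
  have [eA' _ _] := sA'.
  exact: (below_far (essential_map Gg' eA') egA dis' bel' fw).
apply: filterS2 up low => w h1 h2.
by rewrite ltr_norml; apply/andP; split; lra.
Qed.

End height.

(** * Essential continua produced by the twist *)

Section twist.
Variable R : realType.
Local Notation P := (R * R)%type.
Implicit Types (K A B S : set P) (x y z v w : P) (g : P -> P) (d e : R) (n : int).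
Variables (k : int) (G : (P -> P) -> int -> R -> Prop) (C : R).
Hypothesis tG : twist_group k G C.

Let up : P := (0, 1).

Lemma tg_hup g n d z l : G g n d ->
  g (z + hvec R l + up) = g z + hvec R (l + n * k) + up.
Proof.
move=> Gg; rewrite (tg_vert tG _ Gg) (tg_hvec tG _ _ Gg) hvecD -!addrA.
by congr (_ + (_ + _)); apply: pair_ext; rewrite /= ?addr0 ?add0r.
Qed.

(** As [d] is nonzero, only finitely many iterates of [S] meet the strip of heights at most [J]. *)
Lemma chain_bounded g gi n d S (J : R) : G g n d -> cancel g gi -> cancel gi g ->
  d != 0 -> compact S ->
  exists X : R, forall (j : int) z, (ziter g gi j @` S) z -> `|z.2| <= J -> `|z.1| < X.
Proof.
move=> Gg gK giK d0 kS.
have [B B0 hB] := compact_pbounded kS.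
pose N := Num.bound ((B + C + J) / `|d|).
have dp : 0 < `|d| by rewrite normr_gt0.
have hN (j : int) z : (ziter g gi j @` S) z -> `|z.2| <= J -> (`|j| < N)%N.
  move=> [v /hB[_ vB] <-] zJ.
  have := tg_dev tG v (tg_iter tG j Gg gK giK).
  rewrite -(ltr_nat R) => h.
  have : `|j|%:R * `|d| < B + C + J + 0.
    rewrite -[X in X * _](_ : `|j%:~R : R| = _); last by rewrite -intr_norm -abszE.
    rewrite -normrM addr0.
    set y := ziter g gi j v in zJ h *.
    have -> : j%:~R * d = y.2 + (- v.2 - (y.2 - v.2 - j%:~R * d)) by ring.
    apply: le_lt_trans (ler_normD _ _) _; apply: le_lt_trans (lerD (lexx _) (ler_normB _ _)) _.
    by rewrite normrN; lra.
  rewrite addr0 -ltr_pdivlMr // => h1; apply: lt_trans h1 _.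
  apply: archi_boundP; apply: divr_ge0; last exact: ltW.
  have := normr_ge0 (ziter g gi j v).2; have := normr_ge0 ((ziter g gi j v).2 - v.2 - j%:~R * d).
  by lra.
have bd (m : nat) : exists X : R, forall (j : int) z, (`|j| < m)%N ->
    (ziter g gi j @` S) z -> `|z.1| < X.
  elim: m => [|m [X hX]]; first by exists 0.
  have bj j : exists X : R, forall z, (ziter g gi j @` S) z -> `|z.1| < X.
    have kj : compact (ziter g gi j @` S).
      apply: continuous_compact => //; apply: continuous_subspaceT.
      exact: tg_cont tG _ _ _ (tg_iter tG j Gg gK giK).
    by have [X' _ h] := compact_pbounded kj; exists X' => z /h[].
  have [X1 hX1] := bj m; have [X2 hX2] := bj (- m%:Z).
  exists (Num.max X (Num.max X1 X2)) => j z jm hz; rewrite !lt_max.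
  have [lm|ml] := ltnP `|j|%N m; first by rewrite (hX _ _ lm hz).
  have : (j = m \/ j = - m%:Z) by lia.
  by case=> jE; rewrite jE in hz; [rewrite (hX1 _ hz)|rewrite (hX2 _ hz)]; rewrite ?orbT.
have [X hX] := bd N; exists X => j z hz zJ.
exact: hX (hN _ _ hz zJ) hz.
Qed.

(** [cp] and [cm] stand for the images of one point under the iterates [J] and [- J]; the sign of
    [d] decides which of them is the high one. *)
Lemma far_ends (L : set P) (cp cm : P) (x d D Y J : R) : d != 0 ->
  Y + `|x| + D < J * `|d| -> L cp -> L cm ->
  `|cp.2 - x - J * d| <= D -> `|cm.2 - x - - (J * d)| <= D ->
  exists c c', [/\ L c, L c', c.2 < - Y & Y < c'.2].
Proof.
move=> d0 hJ Lp Lm; rewrite !ler_norml => /andP[h1 h2] /andP[h3 h4].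
have x1 := ler_norm x; have x2 := ler_norm (- x); rewrite normrN in x2.
have [dp|dn] := ltP 0 d.
  rewrite (gtr0_norm dp) in hJ.
  exists cm; exists cp; split=> //; lra.
rewrite (ler0_norm dn) mulrN in hJ.
exists cp; exists cm; split=> //; lra.
Qed.

(* If no crossing occurs, then the vertical line formed by the iterates of [S]
   separates the plane, while its vertical translate is pushed across it
   by the twist. *)
Lemma twist_cross g gi n d S x0 : G g n d -> cancel g gi -> cancel gi g ->
  n * k < 0 -> d != 0 -> continuum S -> S x0 -> S (g x0) ->
  exists (i j l : int) y, (ziter g gi i @` S) y /\
    (ziter g gi j @` S) (y + hvec R l + up).
Proof.
move=> Gg gK giK nk d0 cS Sx Sgx; apply: contrapT => no.
pose gz j := ziter g gi j; pose s j := gz j @` S.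
have Gz j : G (gz j) (j * n) (j%:~R * d) by exact: (tg_iter tG j Gg gK giK).
have {}no (i j l : int) y : s i y -> s j (y + hvec R l + up) -> False.
  by move=> h1 h2; apply: no; exists i, j, l, y.
have cs j : continuum (s j) by exact: (continuum_tg tG (Gz j)).
have sx j : s j (gz j x0) /\ s j (gz (j + 1) x0).
  split; first by exists x0.
  exists (g x0) => //; rewrite /gz ziterD //.
have gzs i j z : s j z -> s (i + j) (gz i z).
  by move=> [v Sv <-]; exists v => //; rewrite /gz ziterD.
have sgz i j z : s j (gz i z) -> s (j - i) z.
  move=> /(gzs (- i)); rewrite addrC /gz ziterK //.
(* At the height of [x0 + up] the whole line stays at abscissae below [X] in absolute value, so
   horizontal segments further out avoid it. *)
have [X hX] := chain_bounded (`|x0.2| + 1) Gg gK giK d0 cS.1.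
have avoid (j : int) (t : R) : s j ((x0.1 + t, x0.2 + 1) : P) -> `|x0.1 + t| < X.
  move=> /hX; apply => /=; apply: le_trans (ler_normD _ _) _.
  by rewrite normr1.
pose X1 := Num.max 0 X + `|x0.1| + 1.
have X1l (t : R) : t <= - X1 -> x0.1 + t <= - X.
  have := ler_norm x0.1; have : X <= Num.max 0 X by rewrite le_max lexx orbT.
  by rewrite /X1; lra.
have X1r (t : R) : X1 <= t -> X <= x0.1 + t.
  have := ler_norm (- x0.1); rewrite normrN; have : X <= Num.max 0 X by rewrite le_max lexx orbT.
  by rewrite /X1; lra.
have avl (j : int) (t : R) : t <= - X1 -> ~ s j ((x0.1 + t, x0.2 + 1) : P).
  by move=> /X1l h /avoid; rewrite ltr_norml => /andP[+ _]; rewrite ltNge h.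
have avr (j : int) (t : R) : X1 <= t -> ~ s j ((x0.1 + t, x0.2 + 1) : P).
  by move=> /X1r h /avoid; rewrite ltr_norml => /andP[_]; rewrite ltNge h.
pose N := Num.bound X1.
have X1N : X1 < N%:R.
  have mX : 0 <= Num.max 0 X by rewrite le_max lexx.
  by apply: archi_boundP; rewrite /X1; have := normr_ge0 x0.1; lra.
(* The translated line starts at [l0], on the left of the line. Since [n * k <= -1], the iterate
   [- J] shears its other end to the offset [r >= N], on the right. *)
pose l0 : int := - N%:Z.
pose J : nat := (N + N)%N.
pose r : int := l0 - J%:Z * (n * k).
have rN : N%:Z <= r by rewrite /r /l0 /J; nia.
pose M := (fun z => z + (hvec R l0 + up)) @` chain s 0 J.
have cM : continuum M.
  apply: continuum_map; first exact: shift_continuous.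
  exact: (@continuum_chain _ _ _ _ (fun j => gz j x0)).
have gMr : gz (- J%:Z) (gz J x0 + hvec R l0 + up) = x0 + hvec R r + up.
  rewrite (tg_hup _ _ (Gz _)) [gz _ (gz _ _)]ziterK //.
  by rewrite /r mulrA !mulNr.
have gl (l : int) : gz (- J%:Z) (x0 + hvec R l + up) =
    gz (- J%:Z) (x0 + up) + hvec R l.
  by rewrite addrAC (tg_hvec tG _ _ (Gz _)).
have [B1 B10 hB1] := compact_pbounded (continuum_tg tG (Gz (- J%:Z)) cM).1.
pose q := gz (- J%:Z) (x0 + up).
pose Y := B1 + `|q.2| + `|J%:R * d| + C + `|x0.2| + 2.
have C0 : 0 <= C by apply: le_trans (tg_dev tG x0 Gg).
have [J' hJ'] : exists J' : nat, Y + `|x0.2| + C < J'%:R * `|d|.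
  exists (Num.bound ((Y + `|x0.2| + C) / `|d|)); rewrite -ltr_pdivrMr ?normr_gt0 //.
  apply: archi_boundP; apply: divr_ge0 => //.
  rewrite /Y; have := normr_ge0 q.2; have := normr_ge0 (J%:R * d).
  by have := normr_ge0 x0.2; lra.
pose L := chain s (- J'%:Z) (J' + J').
have cL : continuum L by exact: (@continuum_chain _ _ _ _ (fun j => gz j x0)).
have [X2 X20 hX2] := compact_pbounded cL.1.
(* With this [m] both ends of [K] lie beyond the finite piece [L], the left one after applying the
   iterate [- J]. *)
pose m := (Num.bound (X2 + `|q.1| + `|x0.1|) + N + `|r|)%N.
have hm : X2 + `|q.1| + `|x0.1| < m%:R.
  apply: (@lt_le_trans _ _ (Num.bound (X2 + `|q.1| + `|x0.1|))%:R).
    by apply: archi_boundP; have := normr_ge0 q.1; have := normr_ge0 x0.1; lra.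
  by rewrite ler_nat /m -addnA leq_addr.
have mN : N%:Z <= m%:Z by rewrite /m; lia.
have mr : r <= m%:Z by rewrite /m; lia.
have segE (l l' : int) z : l <= l' ->
    pseg (x0 + hvec R l + up) (x0 + hvec R l' + up) z ->
    exists2 t : R, z = (x0.1 + t, x0.2 + 1) & l%:~R <= t <= l'%:~R.
  move=> ll; have h (l1 : int) : x0 + hvec R l1 + up = (x0.1 + l1%:~R, x0.2 + 1).
    by apply: pair_ext; rewrite /= addr0.
  have llR : (l%:~R : R) <= l'%:~R by rewrite ler_int.
  rewrite !h => /pseg_h[|h1 /andP[h2 h3]]; first by rewrite lerD2l.
  exists (z.1 - x0.1); first by apply: pair_ext; rewrite //= addrC subrK.
  by apply/andP; split; lra.
pose SL := pseg (x0 + hvec R (- m%:Z) + up) (x0 + hvec R l0 + up).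
pose SR := pseg (x0 + hvec R r + up) (x0 + hvec R m + up).
pose a := gz (- J%:Z) (x0 + hvec R (- m%:Z) + up).
(* [K] passes from left to right without meeting the line: the outer segments avoid it by [avl] and
   [avr], the middle piece by the absence of crossings, and [gz (- J)] preserves the union of all
   [s j]. *)
pose K := ((gz (- J%:Z) @` SL) `|` (gz (- J%:Z) @` M)) `|` SR.
have ml0 : - m%:Z <= l0 by rewrite /l0; lia.
have SLE z : SL z -> exists2 t : R, z = (x0.1 + t, x0.2 + 1) & t <= - X1.
  move=> /(segE _ _ _ ml0)[t -> /andP[_ tl]]; exists t => //.
  by move: tl; rewrite /l0 rmorphN /= -pmulrn; lra.
have SRE z : SR z -> exists2 t : R, z = (x0.1 + t, x0.2 + 1) & X1 <= t.
  move=> /(segE _ _ _ mr)[t -> /andP[rt _]]; exists t => //.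
  have : (N%:Z%:~R : R) <= r%:~R by rewrite ler_int.
  by rewrite -pmulrn; lra.
have cK : continuum K.
  apply: (@continuumU _ _ _ (x0 + hvec R r + up)); last exact: continuum_pseg.
  - right; rewrite -gMr; exists (gz J x0 + hvec R l0 + up) => //.
    exists (gz J x0); last by rewrite addrA.
    by apply/chainP; exists J => //; rewrite add0r; exact: (sx _).1.
  - exact: pseg_l.
  apply: (@continuumU _ _ _ (gz (- J%:Z) (x0 + hvec R l0 + up))).
  - by exists (x0 + hvec R l0 + up) => //; exact: pseg_r.
  - exists (x0 + hvec R l0 + up) => //; exists x0; last by rewrite addrA.
    by apply/chainP; exists 0%N => //; rewrite add0r; exact: (sx 0).1.
  - by apply: (continuum_tg tG (Gz _)); exact: continuum_pseg.
  - exact: (continuum_tg tG (Gz _)).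
have Ka : K a by left; left; exists (x0 + hvec R (- m%:Z) + up) => //; exact: pseg_l.
have Kb : K (x0 + hvec R m + up) by right; exact: pseg_r.
have KL : K `&` L = set0.
  rewrite -subset0 => z [Kz /chainP[i _]]; move: (- _ + _) => j sz.
  case: Kz => [[[w /SLE[t wE tX] wz]|[w [u /chainP[i' _]]]]|/SRE[t zE tX]].
  - rewrite -wz in sz; have := sgz _ _ _ sz; rewrite wE.
    exact: avl.
  - move: (0 + _) => i1 su uw wz; rewrite -wz -uw addrA in sz.
    by have := no _ _ _ _ su (sgz _ _ _ sz).
  - by rewrite zE in sz; have := avr _ _ tX sz.
have KY z : K z -> `|z.2| < Y.
  have n1 := normr_ge0 q.2; have n2 := normr_ge0 (J%:R * d); have n3 := normr_ge0 x0.2.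
  case=> [[[w /SLE[t wE tX] <-]|/hB1[_ h]]|/SRE[t -> tX]].
  - have := tg_dev tG w (Gz (- J%:Z)); set v := gz _ w => hv.
    have -> : v.2 = (v.2 - w.2 - (- J%:Z)%:~R * d) + (x0.2 + 1 - J%:R * d).
      by rewrite wE /= rmorphN /= -pmulrn; ring.
    apply: le_lt_trans (ler_normD _ _) _.
    have := ler_normB (x0.2 + 1) (J%:R * d); have := ler_normD x0.2 1; rewrite normr1.
    by rewrite /Y; lra.
  - by rewrite /Y; lra.
  - by have := ler_normD x0.2 1; rewrite normr1 /Y /=; lra.
have LJ (j : int) : (`|j| <= J')%N -> L (gz j x0).
  move=> jJ; apply/chainP; exists (absz (j + J'%:Z)%R); first by lia.
  by rewrite (_ : _ + _ = j); [exact: (sx j).1|lia].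
have hx v : L v -> a.1 < v.1 < (x0 + hvec R m + up).1.
  move=> /hX2[+ _]; rewrite /a gl -/q /= rmorphN /= -pmulrn addr0 ltr_norml => /andP[h1 h2].
  have := ler_norm q.1; have := ler_norm (- x0.1); rewrite normrN.
  have := normr_ge0 q.1; have := normr_ge0 x0.1.
  by move=> *; apply/andP; split; lra.
have hy j : `|(gz j x0).2 - x0.2 - j%:~R * d| <= C by exact: (tg_dev tG _ (Gz j)).
have hyN (j : nat) : `|(gz (- j%:Z) x0).2 - x0.2 - - (j%:R * d)| <= C.
  by have := hy (- j%:Z); rewrite rmorphN /= -pmulrn mulNr.
have Lp : L (gz J' x0) by apply: LJ.
have Lm : L (gz (- J'%:Z) x0) by apply: LJ; rewrite abszN.
have [c [c' [Lc Lc' cY c'Y]]] := far_ends d0 hJ' Lp Lm (hy J'%:Z) (hyN J').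
have [] := continua_cross cK.1 cK.2 cL.1 cL.2 Ka Kb Lc Lc' hx; last by rewrite KL.
by move=> u /KY uY; rewrite (lt_trans cY) ?(lt_trans _ c'Y) //;
  move: uY; rewrite ltr_norml => /andP[].
Qed.


Variable phi : P -> R.
Hypothesis phiG : forall g n d z, G g n d -> phi (g z) = phi z + d.

Lemma phi_hup z l : phi (z + hvec R l + up) = phi z + 1.
Proof.
rewrite -(phiG z (tg_shift tG l 1)); congr (phi _).
by apply: pair_ext; rewrite /= ?addr0.
Qed.

(** If [y] lies on piece [i] and [T y] on piece [j], then [g y] lies on piece [i + 1], and [T (g y)]
    translated by [hvec (n * k)] on piece [j + 1]. So the four pieces together join a point to a
    nonzero horizontal translate of it. The factor [5] is one [e] for a piece, two for matching
    values at the crossing, and two for [|d|]. *)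
Lemma twist_loop g n d S x0 (c e : R) : k != 0 -> G g n d -> n != 0 -> d != 0 ->
  continuum S -> S x0 -> S (g x0) -> (forall z, S z -> `|phi z - c| <= e) ->
  exists A, [/\ essential A, A `&` S !=set0 & forall z, A z -> `|phi z - c| <= 5 * e].
Proof.
move=> k0 Gg n0 d0 cS Sx Sgx hS.
wlog nk : g n d x0 Gg n0 d0 Sx Sgx / n * k < 0.
  move=> H; have : n * k != 0 by rewrite mulf_neq0.
  rewrite neq_lt => /orP[h|h]; first exact: (H _ _ _ _ Gg n0 d0 Sx Sgx h).
  have [gi [Ggi gK giK]] := tg_inv tG Gg.
  by apply: (H gi (- n) (- d) (g x0)); rewrite ?oppr_eq0 ?gK ?mulNr ?oppr_lt0 //.
have [gi [Ggi gK giK]] := tg_inv tG Gg.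
have [i [j [l [y [yi yj]]]]] := twist_cross Gg gK giK nk d0 cS Sx Sgx.
pose gz j := ziter g gi j; pose s j := gz j @` S.
have Gz j1 : G (gz j1) (j1 * n) (j1%:~R * d) by exact: (tg_iter tG j1 Gg gK giK).
have cs j1 : continuum (s j1) by exact: (continuum_tg tG (Gz j1)).
have s1 j1 z : s j1 z -> s (j1 + 1) (g z).
  by move=> [v Sv <-]; exists v => //; rewrite /gz ziterS.
have sx j1 : s (j1 + 1) (gz (j1 + 1) x0) /\ s j1 (gz (j1 + 1) x0).
  by split; [exists x0|exists (g x0) => //; rewrite /gz ziterD].
pose T z := z + hvec R l + up.
have cT S' : continuum S' -> continuum (T @` S').
  by move=> cS'; apply: continuum_map cS' => z; apply: cvgD (@shift_continuous _ _ z) (cvg_cst _).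
pose A0 := ((T @` s (i + 1)) `|` (T @` s i)) `|` (s j `|` s (j + 1)).
have cA0 : continuum A0.
  apply: (@continuumU _ _ _ (T y)); [by right; exists y|by left| |].
  - apply: (@continuumU _ _ _ (T (gz (i + 1) x0))); rewrite ?[T @` _]/=.
    + by exists (gz (i + 1) x0) => //; exact: (sx i).1.
    + by exists (gz (i + 1) x0) => //; exact: (sx i).2.
    + exact: cT.
    + exact: cT.
  - apply: (@continuumU _ _ _ (gz (j + 1) x0)) => //.
    + exact: (sx j).2.
    + exact: (sx j).1.
have ge : g (T y) = T (g y) + hvec R (n * k).
  by rewrite /T (tg_hup _ _ Gg) hvecD !addrA; exact: addrAC.
have phs j1 z : s j1 z -> `|phi z - c - j1%:~R * d| <= e.
  move=> [v /hS + <-]; rewrite (phiG _ (Gz j1)).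
  by rewrite (_ : _ + _ - c - _ = phi v - c) //; ring.
have := phs _ _ yj; have := phs _ _ yi; rewrite phi_hup => py1 py2.
have pd : `|d| <= 2 * e.
  have := hS _ Sx; have := hS _ Sgx; rewrite (phiG _ Gg) !ler_norml.
  by move=> /andP[h1 h2] /andP[h3 h4]; apply/andP; split; lra.
have pA0 z : A0 z -> `|phi z - c - j%:~R * d| <= 5 * e.
  move: py1 py2 pd; rewrite !ler_norml => /andP[h1 h2] /andP[h3 h4] /andP[h5 h6].
  by case=> [[[v /phs hv <-]|[v /phs hv <-]]|[/phs hv|/phs hv]];
    move: hv; rewrite ?phi_hup ?rmorphD /= ?mulrDl ler_norml => /andP[h7 h8];
    apply/andP; split; lra.
pose A := gz (- j) @` A0.
exists A; split.
- apply: (essential_map tG (Gz (- j))); split=> //.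
  exists (T (g y)), (n * k); split; first by rewrite mulf_neq0.
    by left; left; exists (g y) => //; exact: s1.
  by right; right; rewrite -ge; exact: s1.
- exists x0; split=> //; exists (gz j x0); first by right; left; exists x0.
  by rewrite /gz ziterK.
- move=> _ [v /pA0 + <-]; rewrite (phiG _ (Gz _)) rmorphN mulNr.
  by rewrite (_ : _ - _ - c = phi v - c - j%:~R * d) //; ring.
Qed.

Theorem equivariant_height (p : P) (C' : R) : k != 0 ->
  (forall z, `|phi z - z.2| <= C') ->
  (forall g n d, G g n d -> n != 0 -> d != 0) ->
  {for p, continuous phi} ->
  (forall r : R, 0 < r -> exists g n d x,
    [/\ G g n d, n != 0, ball p r x & ball p r (g x)]) ->
  exists2 h : P -> R, continuous h &
    forall g n d z, G g n d -> h (g z) = h z + d.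
Proof.
move=> k0 phi_y irr cphi rec.
have near_p (e : R) : 0 < e -> exists2 r : R, 0 < r &
    forall z, ball p r z -> `|phi z - phi p| <= e.
  move=> e0; have /cvgrPdist_lt /(_ e e0) := cphi.
  move=> /nbhs_ballP[r /= r0 hr]; exists r => // z /hr /=.
  by rewrite distrC; exact: ltW.
have small_d (e : R) : 0 < e -> exists g n d, G g n d /\ 0 < `|d| < e.
  move=> e0; have [|r r0 hr] := near_p (e / 3); first by rewrite divr_gt0.
  have [g [n [d [x [Gg n0 xp gxp]]]]] := rec r r0.
  exists g, n, d; split=> //; rewrite normr_gt0 (irr _ _ _ Gg n0) /=.
  have := hr _ xp; have := hr _ gxp; rewrite (phiG _ Gg) !ler_norml ltr_norml.
  by move=> /andP[h1 h2] /andP[h3 h4]; apply/andP; split; lra.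
have small_ex (e : R) : 0 < e -> exists A, small_at phi p e A.
  (* The division by [5] compensates the loss in [twist_loop]. *)
  move=> e0; have [|r r0 hr] := near_p (e / 5); first by rewrite divr_gt0.
  have [g [n [d [x [Gg n0 xp gxp]]]]] := rec r r0.
  have d0 := irr _ _ _ Gg n0.
  have hS z : pseg x (g x) z -> `|phi z - phi p| <= e / 5.
    by move=> xz; apply: hr; exact: pseg_ball xz.
  have [A [eA [u [Au xu]] hA]] := twist_loop k0 Gg n0 d0 (continuum_pseg x (g x))
    (pseg_l _ _) (pseg_r _ _) hS.
  (* The added segment makes the continuum pass through [p] while staying in the ball where [phi] is
     controlled. *)
  exists (A `|` pseg u p); split.
  - split; first exact: (continuumU Au (pseg_l u p) eA.1 (continuum_pseg _ _)).
    by have [a [l [l0 Aa Al]]] := eA.2; exists a, l; split=> //; left.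
  - by right; exact: pseg_r.
  - move=> z [/hA|uz]; first by lra.
    apply: (@le_trans _ _ (e / 5)); last by lra.
    apply: hr; apply: pseg_ball uz; last exact: ballxx.
    exact: pseg_ball xu.
exists (height G phi p).
- exact: (height_continuous tG phiG phi_y small_ex small_d).
- by move=> g n d z Gg; exact: (heightG tG phiG phi_y small_ex z Gg).
Qed.

End twist.

(** * Lifting to the plane *)

Section covering.
Local Open Scope quotient_scope.
Variable R : realType.
Local Notation P := (R * R)%type.
Local Notation cpi := (\pi_(circle R) : R -> circle R).
Local Notation tpi := (\pi_(torus R) : P -> torus R).
Implicit Types (z m w : P).

Lemma cpi_continuous : continuous cpi.
Proof. exact: pi_continuous. Qed.

Lemma tpi_continuous : continuous tpi.
Proof. exact: pi_continuous. Qed.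

Lemma cpiP x y : cpi x = cpi y <-> x - y \is a Num.int.
Proof. exact: eq_pi_circle. Qed.

Definition pint m := (m.1 \is a Num.int) && (m.2 \is a Num.int).

Lemma tpiP z w : tpi z = tpi w <-> pint (z - w).
Proof. exact: eq_pi_torus. Qed.

Lemma tpi_shift z m : pint m -> tpi (z + m) = tpi z.
Proof. by move=> hm; apply/tpiP; rewrite addrC addKr. Qed.

Lemma cpi_surj t : exists x, cpi x = t.
Proof. by exists (repr t); rewrite reprK. Qed.

Lemma tpi_surj p : exists z, tpi z = p.
Proof. by exists (repr p); rewrite reprK. Qed.

Lemma cpi_open (U : set R) : open U -> open (cpi @` U).
Proof.
move=> oU; have -> : (open (cpi @` U) : Prop) = open (cpi @^-1` (cpi @` U)) by [].
have -> : cpi @^-1` (cpi @` U) =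
    \bigcup_(m in [set m : R | m \is a Num.int]) ((fun x => x + m) @^-1` U).
  apply/seteqP; split=> [x [y Uy /cpiP yx]|x [m mi Um]].
    by exists (y - x) => //=; rewrite addrC subrK.
  by exists (x + m) => //; apply/cpiP; rewrite addrC addKr.
apply: bigcup_open => m _; apply: open_comp => // x _.
by apply: cvgD; [exact: cvg_id|exact: cvg_cst].
Qed.

Lemma tpi_open (U : set P) : open U -> open (tpi @` U).
Proof.
move=> oU; have -> : (open (tpi @` U) : Prop) = open (tpi @^-1` (tpi @` U)) by [].
have -> : tpi @^-1` (tpi @` U) =
    \bigcup_(m in [set m : P | pint m]) ((fun x => x + m) @^-1` U).
  apply/seteqP; split=> [x [y Uy /tpiP yx]|x [m mi Um]].
    by exists (y - x) => //=; rewrite addrC subrK.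
  by exists (x + m) => //; apply: tpi_shift.
by apply: bigcup_open => m _; apply: open_comp => // x _; exact: shift_continuous.
Qed.

Lemma small_int (x : R) : x \is a Num.int -> `|x| < 1 -> x = 0.
Proof.
move=> /intrP[i ->]; rewrite -intr_norm (_ : 1 = 1%:~R) // ltr_int => h.
by rewrite (_ : i = 0) //; lia.
Qed.

Lemma cpi_near t0 (e : R) a : 0 < e -> cpi a = t0 -> nbhs t0 (cpi @` ball a e).
Proof.
move=> e0 at0; apply: open_nbhs_nbhs; split; first by apply: cpi_open; exact: ball_open.
by exists a => //; exact: ballxx.
Qed.

(** Two angles below [1 / 4] in absolute value are equal once they agree modulo integers, so the
    angle is determined by the two points. *)
Definition cclose (t t' : circle R) := exists2 u : R, `|u| < 1 / 4 & t' = rotation u t.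

Lemma rotation0 t : rotation (0 : R) t = t.
Proof. by have [x <-] := cpi_surj t; rewrite rotationE addr0. Qed.

Lemma rotationD (a b : R) t : rotation a (rotation b t) = rotation (b + a) t.
Proof. by have [x <-] := cpi_surj t; rewrite !rotationE addrA. Qed.

Lemma rotation_eq (a b : R) t : rotation a t = rotation b t -> a - b \is a Num.int.
Proof.
have [x <-] := cpi_surj t; rewrite !rotationE => /cpiP.
by rewrite opprD addrACA subrr add0r.
Qed.

Lemma cclose_sym t t' : cclose t t' -> cclose t' t.
Proof.
by move=> [u hu ->]; exists (- u); rewrite ?normrN // rotationD subrr rotation0.
Qed.

Lemma cclose_ball a t t' : (cpi @` ball a (1 / 8)) t -> (cpi @` ball a (1 / 8)) t' ->
  cclose t t'.
Proof.
move=> [x + <-] [y + <-]; rewrite -ball_normE /= => ax ay.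
exists (y - x); last by rewrite rotationE addrC subrK.
have -> : y - x = (a - x) - (a - y) by ring.
by rewrite (le_lt_trans (ler_normB _ _)) //; lra.
Qed.

(** By uniqueness of the small angle, the chosen [u] coincides near [x0] with the difference [c - b]
    of local representatives. *)
Lemma cclose_lift (X : topologicalType) (g g' : X -> circle R) :
  continuous g -> continuous g' -> (forall x, cclose (g x) (g' x)) ->
  exists2 u : X -> R, continuous u & forall x, g' x = rotation (u x) (g x).
Proof.
move=> cg cg' close.
have /choice[u hu] x : exists u : R, `|u| < 1 / 4 /\ g' x = rotation u (g x).
  by have [u] := close x; exists u.
exists u => [|x]; last by have [] := hu x.
move=> x0; apply/cvgrPdist_lt => e e0.
have [a ga] := cpi_surj (g x0).
pose eta := Num.min (e / 4) (1 / 8).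
have eta0 : 0 < eta by rewrite lt_min !divr_gt0.
have eta8 : eta <= 1 / 8 by rewrite ge_min lexx orbT.
have etae : eta <= e / 4 by rewrite ge_min lexx.
have [hu0 gu0] := hu x0.
have ga' : cpi (a + u x0) = g' x0 by rewrite gu0 -ga rotationE.
have n1 : \forall x \near x0, (cpi @` ball a eta) (g x) := cg x0 _ (cpi_near eta0 ga).
have n2 : \forall x \near x0, (cpi @` ball (a + u x0) eta) (g' x) :=
  cg' x0 _ (cpi_near eta0 ga').
apply: filterS2 n1 n2 => x /= [b + bx] [c + cx]; rewrite -!ball_normE /= => hb hc.
have [hux gux] := hu x.
have : (u x - (c - b)) \is a Num.int.
  by apply: (@rotation_eq _ _ (g x)); rewrite -gux -bx rotationE addrC subrK cx.
move: hb hc hux hu0; rewrite !ltr_norml => /andP[h1 h2] /andP[h3 h4] /andP[h5 h6] /andP[h7 h8].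
move=> /small_int h; have {}h : u x - (c - b) = 0.
  by apply: h; rewrite ltr_norml; apply/andP; split; lra.
by apply/andP; split; lra.
Qed.

(** The times at which the accumulated angle has a continuous choice form a set open and closed in
    the unit interval; compactness of [K] lets one short time step serve all points at once. The map
    [c] allows a noncompact [X], such as the plane retracted onto a square. *)
Lemma homotopy_lift (X Y : topologicalType) (K : set Y) (c : X -> Y)
    (H : R * Y -> circle R) :
  compact K -> continuous c -> (forall x, K (c x)) ->
  {within [set tx | tx.1 \in `[0, 1]], continuous H} ->
  exists2 D : X -> R, continuous D &
    forall x, H (1, c x) = rotation (D x) (H (0, c x)).
Proof.
move=> kK cc cK /subspace_continuousP cH.
have cHt (t : R) : t \in `[0, 1] -> continuous (fun x => H (t, c x)).
  move=> t01 x U nU; have hU := cH (t, c x) t01 U nU.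
  have : nbhs x (fun x' => (t, c x').1 \in `[0, 1] -> U (H (t, c x'))).
    have c1 : (fun _ : X => t) @ x --> t by exact: cvg_cst.
    have ct : (fun x' : X => (t, c x') : R * Y) @ x --> (t, c x).
      by exact: (cvg_pair c1 (cc x)).
    exact: ct _ hU.
  by apply: filterS => x' /(_ t01).
pose Q t := exists2 D : X -> R, continuous D &
  forall x, H (t, c x) = rotation (D x) (H (0, c x)).
have Qstep (t t' : R) : t \in `[0, 1] -> t' \in `[0, 1] ->
    (forall x, cclose (H (t, c x)) (H (t', c x))) -> Q t -> Q t'.
  move=> t01 t'01 close [D cD hD].
  have [u cu hu] := cclose_lift (cHt _ t01) (cHt _ t'01) close.
  exists (fun x => D x + u x) => [x|x].
    by apply: cvgD; [exact: cD|exact: cu].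
  by rewrite hu hD rotationD.
have Qnear (t0 : R) : t0 \in `[0, 1] -> \forall t \near t0, t \in `[0, 1] ->
    forall x, cclose (H (t0, c x)) (H (t, c x)).
  move=> t01.
  have := (compact_near_coveringP _).1 kK R (nbhs t0)
    (fun t y => t \in `[0, 1] -> cclose (H (t0, y)) (H (t, y))).
  move=> cov.
  unshelve epose proof (cov _ _) as W.
  - move=> x _; have [a ha] := cpi_surj (H (t0, x)).
    have e8 : (0 : R) < 1 / 8 by rewrite divr_gt0.
    have [[/= A B] [nA nB] hAB] := cH (t0, x) t01 _ (cpi_near e8 ha).
    exists (B, A) => //= -[x' t] /= [Bx At] t'01.
    apply: (@cclose_ball a); last exact: (hAB (t, x')).
    by apply: (hAB (t0, x')) => //; split => //; exact: nbhs_singleton.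
  - by apply: filterS W => t ht t'01 x; exact: ht.
suff QI : [set t | t \in `[0, 1] /\ Q t] = [set` `[0, 1]%R].
  have : [set` `[(0 : R), 1]%R] 1 by rewrite /= in_itv /= ler01 lexx.
  by rewrite -QI => -[_].
apply: (@segment_connected R 0 1).
- exists 0; split; first by rewrite in_itv /= ler01 lexx.
  by exists (cst 0) => [x|x]; [exact: cvg_cst|rewrite rotation0].
- exists (interior [set t | t \in `[0, 1] -> Q t]); first exact: open_interior.
  apply/seteqP; split=> t /=.
    move=> [t01 Qt]; split=> //; apply: filterS (Qnear _ t01) => t' ht' t'01.
    exact: Qstep t01 t'01 (ht' t'01) Qt.
  by move=> [t01 /nbhs_singleton]; split=> //; auto.
- exists (closure [set t | t \in `[0, 1] /\ Q t]); first exact: closed_closure.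
  apply/seteqP; split=> t /=; first by move=> [t01 Qt]; split=> //; exact: subset_closure.
  move=> [t01 /(_ _ (Qnear _ t01))[t' [[t'01 Qt'] ht']]]; split=> //.
  apply: Qstep Qt' => // x; apply: cclose_sym; exact: ht'.
Qed.

End covering.

(** * Lifts of maps isotopic to the twist *)

Section lifts.
Local Open Scope quotient_scope.
Variable R : realType.
Local Notation P := (R * R)%type.
Local Notation cpi := (\pi_(circle R) : R -> circle R).
Local Notation tpi := (\pi_(torus R) : P -> torus R).
Implicit Types (z m w : P).

Lemma pintD m m' : pint m -> pint m' -> pint (m + m').
Proof. by move=> /andP[? ?] /andP[? ?]; apply/andP; split; exact: rpredD. Qed.

Lemma pintN m : pint (- m) = pint m.
Proof. by rewrite /pint /= !rpredN. Qed.

Lemma pint_hvec l : pint (hvec R l).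
Proof. by rewrite /pint /= intr_int rpred0. Qed.

Lemma unit_square_rep z : exists2 m, pint m & `[0, 1]%classic (z - m).1 /\ `[0, 1]%classic (z - m).2.
Proof.
exists ((Num.floor z.1)%:~R, (Num.floor z.2)%:~R); first by rewrite /pint /= !intr_int.
have fl (x : R) : `[0, 1]%classic (x - (Num.floor x)%:~R).
  have /andP[h1 h2] := floor_itv x; rewrite rmorphD /= in h2.
  by rewrite /= in_itv /=; apply/andP; split; lra.
by split; exact: fl.
Qed.

Lemma compact_unit_square : compact (`[0, 1]%classic `*` `[0, 1]%classic : set P).
Proof. by apply: compact_setX; exact: segment_compact. Qed.

Lemma torus_compact : compact [set: torus R].
Proof.
have -> : [set: torus R] = tpi @` (`[0, 1]%classic `*` `[0, 1]%classic).
  apply/seteqP; split=> // p _; have [z <-] := tpi_surj p.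
  have [m hm sq] := unit_square_rep z; exists (z - m) => //.
  by apply: tpi_shift; rewrite pintN.
apply: continuous_compact; last exact: compact_unit_square.
by apply: continuous_subspaceT; exact: tpi_continuous.
Qed.

Lemma continuum_pconst (u : P -> R) : continuous u -> (forall z, u z \is a Num.int) ->
  forall z w, u z = u w.
Proof.
move=> cu iu z w.
have cI : connected (u @` pseg z w).
  apply: connected_continuous_connected; first exact: (continuum_pseg z w).2.
  exact: continuous_subspaceT.
have le x y : x \in [set z; w] -> y \in [set z; w] -> u x <= u y.
  move=> hx hy; rewrite leNgt; apply/negP => lt.
  have mem v : v \in [set z; w] -> (u @` pseg z w) (u v).
    by rewrite inE => -[] ->; [exists z => //; exact: pseg_l|exists w => //; exact: pseg_r].
  have /connected_intervalP := cI.
  have /intrP[i ui] := iu x; have /intrP[j uj] := iu y.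
  have ji : j + 1 <= i by move: lt; rewrite ui uj ltr_int; lia.
  have jiR : u y + 1 <= u x by rewrite ui uj -[1]/(1%:~R) -rmorphD /= ler_int.
  move=> /(_ (u y) (u x) (mem _ hy) (mem _ hx) (u y + 1 / 2))[|v _ uv].
    by apply/andP; split; lra.
  have : (u v - u y) \is a Num.int by exact: rpredB.
  rewrite uv addrAC subrr add0r => /small_int; rewrite ger0_norm ?divr_ge0 // => h.
  have : (1 / 2 : R) = 0 by apply: h; lra.
  by lra.
have zI : z \in [set z; w] by rewrite inE; left.
have wI : w \in [set z; w] by rewrite inE; right.
by apply/eqP; rewrite eq_le !le.
Qed.

Lemma periodic_bounded (u : P -> R) : continuous u ->
  (forall z m, pint m -> u (z + m) = u z) -> exists B : R, forall z, `|u z| <= B.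
Proof.
move=> cu pu.
have kI : compact (u @` (`[0, 1]%classic `*` `[0, 1]%classic)).
  apply: continuous_compact; last exact: compact_unit_square.
  exact: continuous_subspaceT.
have [B [_ hB]] := compact_bounded kI.
exists (B + 1) => z; have [m hm sq] := unit_square_rep z.
rewrite -(pu z (- m)) ?pintN //; apply: (hB (B + 1)); first by rewrite ltrDl.
by exists (z - m).
Qed.

Definition torus_fst (p : torus R) : circle R := cpi (repr p).1.
Definition torus_snd (p : torus R) : circle R := cpi (repr p).2.

Lemma torus_fstE z : torus_fst (tpi z) = cpi z.1.
Proof.
apply/cpiP; have /tpiP/andP[] : tpi (repr (tpi z)) = tpi z by rewrite reprK.
by [].
Qed.

Lemma torus_sndE z : torus_snd (tpi z) = cpi z.2.
Proof.
apply/cpiP; have /tpiP/andP[] : tpi (repr (tpi z)) = tpi z by rewrite reprK.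
by [].
Qed.

Lemma tc_inj p q : torus_fst p = torus_fst q -> torus_snd p = torus_snd q -> p = q.
Proof.
have [z <-] := tpi_surj p; have [w <-] := tpi_surj q; rewrite !torus_fstE !torus_sndE.
by move=> /cpiP h1 /cpiP h2; apply/tpiP/andP.
Qed.

Lemma torus_fst_continuous : continuous torus_fst.
Proof.
apply/quotient_continuous => z; rewrite /continuous_at.
have -> : torus_fst \o tpi = cpi \o fst by apply/funext => x; exact: torus_fstE.
by apply: continuous_comp; [exact: cvg_fst|exact: cpi_continuous].
Qed.

Lemma torus_snd_continuous : continuous torus_snd.
Proof.
apply/quotient_continuous => z; rewrite /continuous_at.
have -> : torus_snd \o tpi = cpi \o snd by apply/funext => x; exact: torus_sndE.
by apply: continuous_comp; [exact: cvg_snd|exact: cpi_continuous].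
Qed.

Definition equivariant (k : int) (F : P -> P) :=
  forall z m, pint m -> F (z + m) = F z + (m.1 + k%:~R * m.2, m.2).

(** The isotopy starts at the twist, which has a linear lift. The angles swept by the two circle
    coordinates are functions on the torus, hence periodic, and adding them keeps the
    equivariance. *)
Lemma lift_ex k f : isotopic R (dehn_twist k) f ->
  exists F, is_lift f F /\ equivariant k F.
Proof.
move=> [H [cH _ H0 H1]].
have comp (t : torus R -> circle R) : continuous t ->
    {within [set tx | tx.1 \in `[0, 1]], continuous (t \o H)}.
  move=> ct; apply/subspace_continuousP => x Ax.
  by apply: cvg_comp; [exact: ((subspace_continuousP _ _).1 cH x Ax)|exact: ct].
have cid : continuous (fun p : torus R => p) by move=> p; exact: cvg_id.
have [D1 cD1 hD1] := homotopy_lift torus_compact cid (fun=> I) (comp _ torus_fst_continuous).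
have [D2 cD2 hD2] := homotopy_lift torus_compact cid (fun=> I) (comp _ torus_snd_continuous).
have cc (D : torus R -> R) : continuous D -> continuous (D \o tpi).
  by move=> cD x; apply: continuous_comp; [exact: tpi_continuous|exact: cD].
exists (fun z => (z.1 + k%:~R * z.2 + (D1 \o tpi) z, z.2 + (D2 \o tpi) z)).
split; [split|].
- move=> z; apply: cvg_pairR; apply: cvgD; try exact: cc.
    apply: cvgD; first exact: cvg_fst.
    by apply: cvgM; [exact: cvg_cst|exact: cvg_snd].
  exact: cvg_snd.
- move=> z; rewrite -H1; apply: tc_inj.
    by rewrite [RHS]hD1 /= H0 dehn_twistE !torus_fstE rotationE.
  by rewrite [RHS]hD2 /= H0 dehn_twistE !torus_sndE rotationE.
- by move=> z m hm; apply: pair_ext; rewrite /= tpi_shift //; ring.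
Qed.

(** Two lifts differ by a continuous integer vector, hence by a constant one. *)
Lemma lift_equivariant k f F : isotopic R (dehn_twist k) f -> is_lift f F ->
  equivariant k F.
Proof.
move=> /lift_ex[F0 [[cF0 hF0] eF0]] [cF hF] z m hm.
have hd v : pint (F v - F0 v) by apply/tpiP; rewrite hF hF0.
have c1 : continuous (fun v => (F v - F0 v).1).
  move=> v; apply: (@continuous_comp _ _ _ (fun v => F v - F0 v) fst); last exact: cvg_fst.
  by apply: cvgB; [exact: cF|exact: cF0].
have c2 : continuous (fun v => (F v - F0 v).2).
  move=> v; apply: (@continuous_comp _ _ _ (fun v => F v - F0 v) snd); last exact: cvg_snd.
  by apply: cvgB; [exact: cF|exact: cF0].
have e1 := continuum_pconst c1 (fun v => let: conj a _ := andP (hd v) in a) (z + m) z.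
have e2 := continuum_pconst c2 (fun v => let: conj _ b := andP (hd v) in b) (z + m) z.
have : F (z + m) - F0 (z + m) = F z - F0 z by exact: pair_ext.
rewrite eF0 // => /(canRL (subrK _)) ->.
by rewrite addrA subrK.
Qed.

Lemma equivariant_inv k F Fi : equivariant k F -> cancel F Fi -> cancel Fi F ->
  equivariant (- k) Fi.
Proof.
move=> eF FK FiK z m hm; apply: (can_inj FK); rewrite FiK eF.
  rewrite FiK; congr (_ + _); apply: pair_ext => //=.
  by rewrite rmorphN mulNr subrK.
move: hm => /andP[h1 h2]; rewrite /pint /= h2 andbT rpredD // rpredM //.
by rewrite intr_int.
Qed.

(** Bijectivity follows from that of [f] and equivariance. For continuity of the inverse, [F] is at
    bounded distance from a linear automorphism, so the points with image near [w0] lie in a compact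
    box, and [F] maps closed subsets of the box to closed sets. *)
Lemma lift_homeo k f F : is_homeo f -> is_lift f F -> equivariant k F ->
  exists Fi, [/\ continuous Fi, cancel F Fi & cancel Fi F].
Proof.
move=> [_ [fi [_ fK fiK]]] [cF hF] eF.
have injF z w : F z = F w -> z = w.
  move=> zw; have : tpi z = tpi w by rewrite -[tpi z]fK -[tpi w]fK -!hF zw.
  move=> /tpiP hm; have := eF w _ hm; rewrite [w + _]addrC subrK zw.
  move=> /esym/eqP; rewrite -subr_eq0 addrAC subrr add0r => /eqP [].
  move=> /[swap] h2; rewrite h2 mulr0 addr0 => h1.
  by apply/eqP; rewrite -subr_eq0; apply/eqP; exact: pair_ext.
have surjF w : exists z, F z = w.
  have [z hz] := tpi_surj (fi (tpi w)).
  have /tpiP hm : tpi w = tpi (F z) by rewrite hF hz fiK.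
  pose m := w - F z.
  exists (z + (m.1 - k%:~R * m.2, m.2)); rewrite eF.
    by apply: pair_ext; rewrite /= /m /=; ring.
  move: hm => /andP[h1 h2]; rewrite /pint /= h2 andbT rpredB // rpredM //.
  by rewrite intr_int.
have /choice[Fi FiK] := surjF.
have FK : cancel F Fi by move=> z; apply: injF; rewrite FiK.
exists Fi; split=> //.
have [B1 hB1] : exists B, forall z, `|(F z).1 - z.1 - k%:~R * z.2| <= B.
  apply: periodic_bounded => [z|z m hm]; last by rewrite eF //=; ring.
  apply: cvgB; last by apply: cvgM; [exact: cvg_cst|exact: cvg_snd].
  apply: cvgB; last exact: cvg_fst.
  by apply: continuous_comp; [exact: cF|exact: cvg_fst].
have [B2 hB2] : exists B, forall z, `|(F z).2 - z.2| <= B.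
  apply: periodic_bounded => [z|z m hm]; last by rewrite eF //=; ring.
  apply: cvgB; last exact: cvg_snd.
  by apply: continuous_comp; [exact: cF|exact: cvg_snd].
move=> w0; apply/cvgrPdist_lt => e e0.
pose b2 := `|w0.2| + 1 + B2; pose b1 := `|w0.1| + 1 + B1 + `|k%:~R| * b2.
pose Q := (`[- b1, b1]%classic `*` `[- b2, b2]%classic) `&` ~` ball (Fi w0) e.
have kQ : compact Q.
  apply: compact_closedI; first by apply: compact_setX; exact: segment_compact.
  by apply: open_closedC; exact: ball_open.
have clQ : closed (F @` Q).
  apply: compact_closed; first exact: norm_hausdorff.
  by apply: continuous_compact => //; exact: continuous_subspaceT.
have nw0 : ~ (F @` Q) w0.
  by move=> [z [_ hz] zw]; apply: hz; rewrite -zw FK; exact: ballxx.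
have nQ : \forall w \near w0, ~ (F @` Q) w.
  by apply: open_nbhs_nbhs; split; [exact: closed_openC|].
apply: filterS2 nQ (nbhsx_ballx w0 1 ltr01) => w hw.
rewrite -ball_normE /= pnorm_lt => /andP[/= h1 h2].
apply: contrapT => hd; apply: hw; exists (Fi w); last exact: FiK.
split; last by rewrite -ball_normE.
have := hB1 (Fi w); have := hB2 (Fi w); rewrite FiK.
set x := (Fi w).1; set y := (Fi w).2 => e2 e1.
have y2 : `|y| <= b2.
  have -> : y = - (w.2 - y) + (w0.2 - (w0.2 - w.2)) by ring.
  have := ler_normD (- (w.2 - y)) (w0.2 - (w0.2 - w.2)).
  by have := ler_normB w0.2 (w0.2 - w.2); rewrite normrN /b2; lra.
have x1 : `|x| <= b1.
  have -> : x = - (w.1 - x - k%:~R * y) + (w0.1 - (w0.1 - w.1)) - k%:~R * y by ring.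
  have := ler_normB (- (w.1 - x - k%:~R * y) + (w0.1 - (w0.1 - w.1))) (k%:~R * y).
  have := ler_normD (- (w.1 - x - k%:~R * y)) (w0.1 - (w0.1 - w.1)).
  have := ler_normB w0.1 (w0.1 - w.1); rewrite normrN normrM.
  have : `|k%:~R : R| * `|y| <= `|k%:~R| * b2 by rewrite ler_wpM2l.
  by rewrite /b1; lra.
by split; rewrite /= in_itv /= -ler_norml.
Qed.

End lifts.

(** * From factors to deviations *)

Section forward.
Local Open Scope quotient_scope.
Variable R : realType.
Local Notation P := (R * R)%type.
Local Notation cpi := (\pi_(circle R) : R -> circle R).
Local Notation tpi := (\pi_(torus R) : P -> torus R).
Implicit Types (z m w : P).

Lemma irrational_affine (rho : R) (n m : int) : irrational rho -> n != 0 ->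
  n%:~R * rho + m%:~R != 0.
Proof.
move=> irr n0; apply/eqP => h; apply: irr.
have nR : (n%:~R : R) != 0 by rewrite intr_eq0.
exists (- m%:~R / n%:~R) => //.
rewrite fmorph_div rmorphN /= !ratr_int; apply: (mulfI nR).
by rewrite mulrC divfK //; lra.
Qed.

Lemma irrational_div (a : R) (j b : int) : irrational a -> b != 0 ->
  irrational ((a + j%:~R) / b%:~R).
Proof.
move=> irr b0 [q _ hq]; apply: irr; exists (q * b%:~R - j%:~R) => //.
have bR : (b%:~R : R) != 0 by rewrite intr_eq0.
by rewrite rmorphB rmorphM /= !ratr_int hq divfK // addrK.
Qed.

Definition clamp (K x : R) : R := Num.max (- K) (Num.min K x).

Lemma clamp_continuous K : continuous (clamp K).
Proof.
move=> x; apply: (@continuous_max R R (cst (- K)) (fun x => Num.min K x)).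
  exact: cvg_cst.
by apply: (@continuous_min R R (cst K) id); [exact: cvg_cst|exact: cvg_id].
Qed.

Lemma clamp_itv K x : 0 <= K -> - K <= clamp K x <= K.
Proof.
by move=> K0; rewrite le_max lexx /= ge_max ge_min lexx /= andbT; lra.
Qed.

Lemma clampE K x : - K <= x <= K -> clamp K x = x.
Proof. by move=> /andP[h1 h2]; rewrite /clamp min_r // max_r. Qed.

Definition pclamp (K : R) z : P := (clamp K z.1, clamp K z.2).

Lemma pclamp_continuous K : continuous (pclamp K).
Proof.
move=> z; apply: cvg_pairR.
  by apply: (@continuous_comp _ _ _ fst (clamp K)); [exact: cvg_fst|exact: clamp_continuous].
by apply: (@continuous_comp _ _ _ snd (clamp K)); [exact: cvg_snd|exact: clamp_continuous].
Qed.

Lemma pclampE K z : `|z| <= K -> pclamp K z = z.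
Proof. by rewrite pnorm_le !ler_norml => /andP[h1 h2]; rewrite /pclamp !clampE //; case: z {h1 h2}. Qed.

Lemma pclamp_norm K z : 0 <= K -> `|pclamp K z| <= K.
Proof. by move=> K0; rewrite pnorm_le !ler_norml /= !clamp_itv. Qed.

(** Contracting a square to [0] is a homotopy from a constant, so [homotopy_lift] applies on each
    square; lifts normalised at [0] agree where they overlap. *)
Lemma plane_lift (g : P -> circle R) : continuous g ->
  exists2 L : P -> R, continuous L & forall z, g z = cpi (L z).
Proof.
move=> cg; have [a0 ha0] := cpi_surj (g 0).
have local (N : nat) : exists L : P -> R,
    [/\ continuous L, L 0 = a0 & forall z, g (pclamp N%:R z) = cpi (L z)].
  pose B : set P := `[- N%:R, N%:R]%classic `*` `[- N%:R, N%:R]%classic.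
  have kB : compact B by apply: compact_setX; exact: segment_compact.
  have NB z : B (pclamp N%:R z) by split; rewrite /= in_itv /=; exact: clamp_itv.
  pose H (tz : R * P) := g (tz.1 *: tz.2).
  have cH : {within [set tx | tx.1 \in `[0, 1]], continuous H}.
    apply: continuous_subspaceT => tz; apply: continuous_comp; last exact: cg.
    by apply: cvgZ; [exact: cvg_fst|exact: cvg_snd].
  have [D cD hD] := homotopy_lift kB (@pclamp_continuous N%:R) NB cH.
  have hDz z : g (pclamp N%:R z) = rotation (D z) (g 0).
    by have := hD z; rewrite /H /= scale1r scale0r.
  have p0 : pclamp N%:R 0 = 0 by rewrite pclampE // normr0.
  have D0 : D 0 \is a Num.int.
    have := hDz 0; rewrite p0 -{1}[g 0]rotation0 => /rotation_eq.
    by rewrite sub0r rpredN.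
  exists (fun z => D z - D 0 + a0); split.
  - move=> z; apply: cvgD; last exact: cvg_cst.
    by apply: cvgB; [exact: cD|exact: cvg_cst].
  - by rewrite subrr add0r.
  - move=> z; rewrite hDz -ha0 rotationE; apply/cpiP.
    by rewrite (_ : _ - _ = D 0) //; ring.
have [L hL] := choice local.
have same (N M : nat) z : `|z| <= N%:R -> `|z| <= M%:R -> L N z = L M z.
  move=> zN zM; wlog NM : N M zN zM / (N <= M)%N.
    by move=> W; case: (leqP N M) => [/W|/ltnW /W] -> //.
  have [cN N0 hN] := hL N; have [cM M0 hM] := hL M.
  pose u x := L N (pclamp N%:R x) - L M (pclamp N%:R x).
  have cu : continuous u.
    move=> x; apply: cvgB; (apply: continuous_comp; first exact: pclamp_continuous).
      exact: cN.
    exact: cM.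
  have iu x : u x \is a Num.int.
    apply/cpiP; rewrite -hN -hM; have nx := @pclamp_norm N%:R x (ler0n _ _).
    by rewrite (pclampE nx) (@pclampE M%:R) // (le_trans nx) // ler_nat.
  have := continuum_pconst cu iu z 0; rewrite /u !pclampE ?normr0 // N0 M0 subrr.
  by move/eqP; rewrite subr_eq0 => /eqP.
pose b (x : R) := Num.bound x.
have hb (x : R) : 0 <= x -> x <= (b x)%:R by move=> x0; apply/ltW/archi_boundP.
exists (fun z => L (b `|z|) z) => [z0|z].
- have [c0 _ _] := hL (b (`|z0| + 1)).
  have : L (b (`|z0| + 1)) @ z0 --> L (b `|z0|) z0.
    rewrite (same _ (b (`|z0| + 1))) ?hb //; first exact: c0.
    by apply: le_trans (hb _ _); [rewrite lerDl|rewrite addr_ge0].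
  apply: cvg_trans; apply: near_eq_cvg.
  apply: filterS (nbhsx_ballx z0 1 ltr01) => z; rewrite -ball_normE /= => zz0.
  apply: same; last exact: hb.
  apply: le_trans (hb _ _); last by rewrite addr_ge0.
  have -> : z = z0 - (z0 - z) by rewrite opprB addrC subrK.
  by apply: le_trans (ler_normB _ _) _; rewrite lerD2l ltW.
- by have [_ _ h] := hL (b `|z|); rewrite -h pclampE // hb.
Qed.


Lemma iterz_ziter (T : Type) (g gi : T -> T) n : cancel g gi -> cancel gi g ->
  iterz g n = ziter g gi n.
Proof.
move=> gK giK; case: n => [//|n] /=.
suff -> : 'pinv_id setT g = gi by [].
apply/funext => x; apply: (can_inj gK); rewrite giK.
by rewrite pinvK // inE; exists (gi x).
Qed.

Lemma factor_deviation k f F : k != 0 -> is_homeo f -> is_lift f F ->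
  equivariant k F -> irrational_rotation_factor f ->
  exists rho C : R, [/\ irrational rho, 0 < C &
    forall z (n : int), `|(iterz F n z - z).2 - n%:~R * rho| <= C].
Proof.
move=> k0 hf lF eF [a [h [irr ch _ hh]]].
have [Fi [_ FK FiK]] := lift_homeo hf lF eF.
have [cF hF] := lF.
have cg : continuous (h \o tpi).
  by move=> z; apply: continuous_comp; [exact: tpi_continuous|exact: ch].
have [L cL hL] := plane_lift cg.
pose c m := L m - L 0.
have hc m z : pint m -> L (z + m) = L z + c m.
  move=> hm.
  have cu : continuous (fun v : P => L (v + m) - L v).
    move=> v; apply: cvgB; last exact: cL.
    by apply: (@continuous_comp _ _ _ (fun v : P => v + m) L); [exact: shift_continuous|exact: cL].
  have iu v : L (v + m) - L v \is a Num.int.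
    by apply/cpiP; rewrite -!hL /= tpi_shift.
  by have := continuum_pconst cu iu z 0; rewrite add0r /c => <-; ring.
have cD m m' : pint m -> pint m' -> c (m + m') = c m + c m'.
  by move=> hm hm'; have := hc m' m hm'; rewrite /c => ->; rewrite /c; ring.
have cint m : pint m -> c m \is a Num.int.
  by move=> hm; apply/cpiP; rewrite -!hL /= -[m]add0r tpi_shift.
have [j hj] : exists j : int, forall z, L (F z) = L z + (a + j%:~R).
  have cu : continuous (fun v : P => L (F v) - L v - a).
    move=> v; apply: cvgB; last exact: cvg_cst.
    apply: cvgB; last exact: cL.
    by apply: (@continuous_comp _ _ _ F L); [exact: cF|exact: cL].
  have iu v : L (F v) - L v - a \is a Num.int.
    by rewrite -addrA -opprD; apply/cpiP; rewrite -rotationE -!hL /= hF hh.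
  have /intrP[j hj] := iu 0; exists j => z.
  by rewrite -hj -(continuum_pconst cu iu z 0); ring.
(* Computing [L (F m)] in two ways shows that the period map [c] is invariant under the twist; this
   kills its value on [hvec 1]. *)
have cF0 m : pint m -> c (m.1 + k%:~R * m.2, m.2) = c m.
  move=> hm; have hm' : pint (m.1 + k%:~R * m.2, m.2).
    move: hm => /andP[h1 h2]; rewrite /pint /= h2 andbT rpredD // rpredM //.
    by rewrite intr_int.
  have := hj (0 + m); rewrite eF // hc // [L (0 + m)]hc // hj => h0.
  by apply: (addrI (L 0 + (a + j%:~R))); rewrite h0; ring.
have ch_ (l : int) : c (hvec R l) = l%:~R * c (hvec R 1).
  have cN m : pint m -> c (- m) = - c m.
    move=> hm; apply/eqP; rewrite -subr_eq0 opprK -cD ?pintN // addNr /c subrr //.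
  have cn (n : nat) : c (hvec R n) = n%:R * c (hvec R 1).
    elim: n => [|n IH]; first by rewrite hvec0 /c subrr mul0r.
    by rewrite -natr1 mulrDl mul1r -IH -cD ?pint_hvec // -hvecD; congr (c (hvec R _)); lia.
  case: (intP l) => [|n|n]; first by rewrite hvec0 /c subrr mul0r.
    exact: cn.
  by rewrite hvecN cN ?pint_hvec // cn rmorphN mulNr.
have pv : pint ((0, 1) : P) by apply/andP; split; [exact: rpred0|exact: rpred1].
have c10 : c (hvec R 1) = 0.
  have := cF0 _ pv; rewrite /= add0r mulr1.
  rewrite (_ : (k%:~R, 1) = hvec R k + (0, 1)); last by apply: pair_ext; rewrite /= ?addr0 ?add0r.
  rewrite cD ?pint_hvec // ch_ => /eqP; rewrite -subr_eq0 addrK mulf_eq0 intr_eq0 (negbTE k0).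
  by move/eqP.
have /intrP[b hb] := cint _ pv.
have cE m : pint m -> c m = m.2 * b%:~R.
  move=> /andP[/intrP[m1 h1] /intrP[m2 h2]].
  have pv2 (l : int) : pint ((0, l%:~R) : P) by apply/andP; split; [exact: rpred0|exact: intr_int].
  have -> : m = hvec R m1 + (0, m2%:~R) by apply: pair_ext; rewrite /= ?addr0 ?add0r.
  rewrite cD ?pint_hvec ?pv2 // ch_ c10 mulr0 add0r /= add0r.
  have cN l : pint l -> c (- l) = - c l.
    move=> hl; apply/eqP; rewrite -subr_eq0 opprK -cD ?pintN // addNr /c subrr //.
  have cn (n : nat) : c (0, n%:~R) = n%:R * b%:~R.
    elim: n => [|n IH]; first by rewrite /c subrr mul0r.
    rewrite -natr1 mulrDl mul1r -IH -hb -cD //; congr c.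
    by apply: pair_ext; [rewrite /= addr0|exact: (esym (natr1 n))].
  case: (intP m2) => [|n|n]; [exact: (cn 0%N)|exact: cn|].
  have -> : ((0, (- n.+1%:Z)%:~R) : P) = - (0, n.+1%:~R) by apply: pair_ext; rewrite /= ?oppr0 ?rmorphN.
  by rewrite cN ?pv2 // cn rmorphN mulNr.
have [B hB] : exists B, forall z, `|L z - z.2 * b%:~R| <= B.
  apply: periodic_bounded => [z|z m hm].
    by apply: cvgB; [exact: cL|apply: cvgM; [exact: cvg_snd|exact: cvg_cst]].
  by rewrite hc // cE //=; ring.
have Ln (n : int) z : L (iterz F n z) = L z + n%:~R * (a + j%:~R).
  rewrite (iterz_ziter _ FK FiK); elim/int_rect: n => [|n IH|n IH].
  - by rewrite mul0r addr0.
  - by rewrite (_ : n.+1%:Z = n%:Z + 1) ?ziterS // ?hj ?IH ?rmorphD /=; [ring|lia].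
  - rewrite (_ : - n.+1%:Z = - n%:Z - 1) ?ziterB //; last lia.
    have := hj (Fi (ziter F Fi (- n%:Z) z)); rewrite FiK IH rmorphB /=.
    by move=> h0; apply: (addIr (a + j%:~R)); rewrite -h0; ring.
(* Otherwise [L] would be bounded, yet it changes by the nonzero amount [a + j] at each
   iteration. *)
have b0 : b != 0.
  apply/eqP => b0; have aj : a + j%:~R != 0.
    by have := @irrational_affine a 1 j irr isT; rewrite mul1r.
  have ajp : 0 < `|a + j%:~R| by rewrite normr_gt0.
  have {}hB z : `|L z| <= B by have := hB z; rewrite b0 mulr0 subr0.
  pose n := Num.bound (2 * B / `|a + j%:~R|).
  have B0 : 0 <= B by apply: le_trans (hB 0).
  have : 2 * B < n%:R * `|a + j%:~R|.
    rewrite -ltr_pdivrMr //; apply: archi_boundP; apply: divr_ge0; last exact: ltW.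
    by rewrite mulr_ge0.
  rewrite -[n%:R]ger0_norm ?ler0n // -normrM.
  have := Ln n 0; have := hB (iterz F n 0); have := hB 0.
  rewrite -pmulrn => h1 h2 h3.
  have -> : n%:R * (a + j%:~R) = L (iterz F n 0) - L 0 by rewrite h3; ring.
  by have := ler_normB (L (iterz F n 0)) (L 0); lra.
have bR : (b%:~R : R) != 0 by rewrite intr_eq0.
have bp : 0 < `|b%:~R : R| by rewrite normr_gt0.
exists ((a + j%:~R) / b%:~R), (2 * B / `|b%:~R| + 1); split.
- exact: irrational_div.
- have : 0 <= 2 * B / `|b%:~R| by rewrite divr_ge0 // mulr_ge0 // (le_trans _ (hB 0)).
  by lra.
- move=> z n; apply: (@le_trans _ _ (2 * B / `|b%:~R|)); last by lra.
  rewrite ler_pdivlMr // -normrM.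
  set y := iterz F n z.
  have -> : ((y - z).2 - n%:~R * ((a + j%:~R) / b%:~R)) * b%:~R =
      (L z - z.2 * b%:~R) - (L y - y.2 * b%:~R).
    by rewrite /y Ln /=; field.
  by have := ler_normB (L z - z.2 * b%:~R) (L y - y.2 * b%:~R);
    have := hB z; have := hB y; lra.
Qed.

End forward.

(** * The group generated by a lift and the integer translations *)

Section lift_group.
Local Open Scope quotient_scope.
Variable R : realType.
Local Notation P := (R * R)%type.
Local Notation tpi := (\pi_(torus R) : P -> torus R).
Implicit Types (z m w : P) (n : int) (d : R).

Lemma pint_twist (k : int) m : pint m -> pint (m.1 + k%:~R * m.2, m.2).
Proof.
move=> /andP[h1 h2]; rewrite /pint /= h2 andbT rpredD // rpredM //.
by rewrite intr_int.
Qed.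

Lemma equivariant_comp k l (g h : P -> P) : equivariant k g -> equivariant l h ->
  equivariant (k + l) (g \o h).
Proof.
move=> eg eh z m hm; rewrite /= eh // eg ?pint_twist //; congr (_ + _).
by apply: pair_ext; rewrite //= rmorphD /=; ring.
Qed.

Variables (k : int) (F Fi : P -> P) (rho C : R).
Hypotheses (cF : continuous F) (cFi : continuous Fi).
Hypotheses (FK : cancel F Fi) (FiK : cancel Fi F).
Hypothesis eF : equivariant k F.
Hypothesis dev : forall z n, `|(ziter F Fi n z - z).2 - n%:~R * rho| <= C.

Local Notation fz := (ziter F Fi).

Lemma ziter_equivariant n : equivariant (n * k) (fz n).
Proof.
have eFi := equivariant_inv eF FK FiK.
elim/int_rect: n => [|n IH|n IH].
- by move=> z m _; rewrite mul0r mul0r addr0; congr (_ + _); case: m.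
- have -> : fz n.+1 = F \o fz n by [].
  rewrite (_ : n.+1%:Z * k = k + n%:Z * k); last lia.
  exact: equivariant_comp.
- have -> : fz (- n.+1%:Z) = Fi \o fz (- n%:Z).
    by apply/funext => z; rewrite (_ : - n.+1%:Z = - n%:Z - 1) ?ziterB //; lia.
  rewrite (_ : - n.+1%:Z * k = - k + - n%:Z * k); last lia.
  exact: equivariant_comp.
Qed.

Lemma ziter_continuous n : continuous (fz n).
Proof.
elim/int_rect: n => [|n IH|n IH]; first by move=> z; exact: cvg_id.
- have -> : fz n.+1 = F \o fz n by [].
  by move=> z; apply: continuous_comp; [exact: IH|exact: cF].
- have -> : fz (- n.+1%:Z) = Fi \o fz (- n%:Z).
    by apply/funext => z; rewrite (_ : - n.+1%:Z = - n%:Z - 1) ?ziterB //; lia.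
  by move=> z; apply: continuous_comp; [exact: IH|exact: cFi].
Qed.

Definition lift_group (g : P -> P) n d := exists m,
  [/\ pint m, forall z, g z = fz n z + m & d = n%:~R * rho + m.2].

Lemma lift_groupP n m : pint m -> lift_group (fun z => fz n z + m) n (n%:~R * rho + m.2).
Proof. by exists m. Qed.

Lemma lift_group_twist : twist_group k lift_group C.
Proof.
split.
- move=> g n d g' n' d' [m [hm gE ->]] [m' [hm' gE' ->]].
  exists ((m'.1 + (n * k)%:~R * m'.2, m'.2) + m); split.
  + by apply: pintD => //; exact: pint_twist.
  + by move=> z; rewrite /= gE gE' ziter_equivariant // ziterD // addrA.
  + by rewrite /= rmorphD /= mulrDl; ring.
- move=> g n d [m [hm gE ->]].
  (* The translation [- m] becomes [m'] when moved through the iterate [- n], which shears it. *)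
  pose m' := (- m.1 + (- n * k)%:~R * - m.2, - m.2).
  have hm' : pint m' by apply: (@pint_twist _ (- m)); rewrite pintN.
  have sh z : fz (- n) (z - m) = fz (- n) z + m' by rewrite ziter_equivariant ?pintN.
  exists (fun z => fz (- n) z + m'); split.
  + exists m'; split=> //; rewrite /m' /= rmorphN mulNr; ring.
  + by move=> z; rewrite /= gE -sh addrK ziterK.
  + move=> z; rewrite gE -sh -[z - m](ziterKN FK FiK n (z - m)).
    by rewrite ziterK // ziterKN // subrK.
- move=> g n d [m [hm gE _]] z.
  have -> : g = fun z => fz n z + m by apply/funext.
  by apply: cvgD; [exact: ziter_continuous|exact: cvg_cst].
- move=> g n d z l [m [hm gE _]]; rewrite !gE ziter_equivariant ?pint_hvec //.
  by rewrite /= mulr0 addr0 addrAC.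
- move=> g n d z [m [hm gE _]]; rewrite !gE ziter_equivariant.
    by rewrite /= mulr1 add0r addrAC.
  by apply/andP; split; [exact: rpred0|exact: rpred1].
- move=> g n d z [m [hm gE ->]]; rewrite gE.
  have := dev z n; set y := fz n z.
  by rewrite (_ : (y + m).2 - _ - _ = (y - z).2 - n%:~R * rho) //=; ring.
- move=> l m; exists (l%:~R, m%:~R); split=> //; first by rewrite /pint /= !intr_int.
  by rewrite mul0r add0r.
Qed.

End lift_group.

(** * Wandering components *)

Section components.
Local Open Scope quotient_scope.
Variable R : realType.
Local Notation P := (R * R)%type.
Local Notation tpi := (\pi_(torus R) : P -> torus R).
Implicit Types (z m w x y : P) (O S : set P).

Lemma connected_ball z (r : R) : connected (ball z r).
Proof.
have [r0|r0] := ltP 0 r; last first.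
  rewrite (_ : ball z r = set0); first exact: connected0.
  rewrite -subset0 => w; rewrite -ball_normE /= => h.
  by have := le_lt_trans (normr_ge0 _) h; lra.
have -> : ball z r = \bigcup_(w in ball z r) pseg z w.
  apply/seteqP; split=> [w zw|v [w zw vz]]; first by exists w => //; exact: pseg_r.
  by apply: pseg_ball vz => //; exact: ballxx.
apply: bigcup_connected; first by exists z => w _; exact: pseg_l.
by move=> w _; exact: (continuum_pseg z w).2.
Qed.

Lemma connected_plane : connected [set: P].
Proof.
have -> : [set: P] = \bigcup_(w in [set: P]) pseg 0 w.
  by apply/seteqP; split=> // w _; exists w => //; exact: pseg_r.
apply: bigcup_connected; first by exists 0 => w _; exact: pseg_l.
by move=> w _; exact: (continuum_pseg 0 w).2.
Qed.

Lemma component_open O z : open O -> open (connected_component O z).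
Proof.
move=> oO; rewrite openE => w zw.
have Ow := connected_component_sub zw.
have := oO; rewrite openE => /(_ _ Ow)/nbhs_ballP[r /= r0 hr].
apply/nbhs_ballP; exists r => // v wv.
apply: connected_component_trans zw _.
by apply: (@connected_component_max _ O (ball w r) w) => //; [exact: ballxx|exact: connected_ball].
Qed.

Lemma component_map (T U : topologicalType) (g : T -> U) (A : set T) (B : set U)
    (a b : T) : continuous g -> (forall t, A t -> B (g t)) ->
  connected_component A a b -> connected_component B (g a) (g b).
Proof.
move=> cg gA ab.
have Aa : A a.
  by apply: contrapT => /connected_component_out E; move: ab; rewrite E.
apply: (@connected_component_max _ _ (g @` connected_component A a)).
- by exists a => //; exact: connected_component_refl.
- by move=> _ [t /connected_component_sub/gA Bt <-].
- apply: connected_continuous_connected; first exact: component_connected.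
  exact: continuous_subspaceT.
- by exists b.
Qed.

(** Otherwise the trace of the component on [S] would be open and closed in [S]. *)
Lemma frontier_in O S z p : open O -> connected S -> O z -> S z -> S p ->
  ~ connected_component O z p ->
  exists y, [/\ S y, closure (connected_component O z) y & ~ O y].
Proof.
move=> oO cS Oz Sz Sp np; apply: contrapT => no.
have oE := @component_open O z oO.
suff SE : S `&` connected_component O z = S by move: Sp; rewrite -SE => -[].
apply: cS.
- by exists z; split=> //; exact: connected_component_refl.
- by exists (connected_component O z).
- exists (closure (connected_component O z)); first exact: closed_closure.
  apply/seteqP; split=> y [Sy hy]; split=> //; first exact: subset_closure.
  apply: contrapT => ny; have [Oy|nOy] := pselect (O y); last by apply: no; exists y.
  have := hy _ (open_nbhs_nbhs (conj (@component_open O y oO) (connected_component_refl Oy))).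
  case=> v [zv yv]; apply: ny.
  by apply: connected_component_trans zv _; exact: connected_component_sym.
Qed.

Lemma euclid_dist_norm z w : `|z - w| <= euclid_dist z w.
Proof.
rewrite pnorm_le /euclid_dist; apply/andP; split; rewrite -sqrtr_sqr ler_wsqrtr //.
  by rewrite lerDl sqr_ge0.
by rewrite lerDr sqr_ge0.
Qed.

Lemma torus_dist_near z w (e : R) : torus_dist (tpi z) (tpi w) < e ->
  exists2 m, pint m & `|z - (w + m)| < e.
Proof.
move=> /inf_lt[].
  by exists (euclid_dist z w); exists z => //; exists w.
move=> _ [u /tpiP hu [v /tpiP hv <-]] uv.
exists ((v - w) - (u - z)); first by apply: pintD => //; rewrite pintN.
have -> : z - (w + (v - w - (u - z))) = u - v.
  by apply: pair_ext => /=; ring.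
exact: le_lt_trans (euclid_dist_norm _ _) uv.
Qed.

(** Makes the [sup] in [torus_diam] that of a bounded set, not a default value. *)
Lemma torus_dist_ubound (p q : torus R) : torus_dist p q <= 2.
Proof.
have [z <-] := tpi_surj p; have [w <-] := tpi_surj q.
have [m hm [zx zy]] := unit_square_rep z; have [m' hm' [wx wy]] := unit_square_rep w.
apply: (@le_trans _ _ (euclid_dist (z - m) (w - m'))).
  apply: ge_inf; first by exists 0 => _ [u _ [v _ <-]]; exact: sqrtr_ge0.
  exists (z - m); first by apply: tpi_shift; rewrite pintN.
  by exists (w - m') => //; apply: tpi_shift; rewrite pintN.
rewrite /euclid_dist.
move: zx zy wx wy; rewrite /= !in_itv /=.
move: (z.1 - m.1) (z.2 - m.2) (w.1 - m'.1) (w.2 - m'.2) => a b c d.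
move=> /andP[a0 a1] /andP[b0 b1] /andP[c0 c1] /andP[d0 d1].
have -> : (2 : R) = Num.sqrt (2 ^+ 2) by rewrite sqrtr_sqr ger0_norm.
by apply: ler_wsqrtr; nra.
Qed.

(** Every point of [S] is within [e] of an integer translate of [z0]. Balls of radius at most
    [1 / 4] at distinct translates are disjoint, so connectedness keeps [S] in the one at [z0]. *)
Lemma small_torus_diam (U : set (torus R)) S (e : R) : connected S ->
  (forall z, S z -> U (tpi z)) -> torus_diam U < e -> e <= 1 / 4 ->
  forall z w, S z -> S w -> `|z - w| < e.
Proof.
move=> cS SU Ue e4 z0 w0 Sz0 Sw0.
have near_e z w : S z -> S w -> exists2 m, pint m & `|z - (w + m)| < e.
  move=> Sz Sw; apply: torus_dist_near; apply: le_lt_trans Ue.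
  apply: sup_upper_bound.
    split; first by exists (torus_dist (tpi z) (tpi z)); exists (tpi z);
      [exact: SU|exists (tpi z) => //; exact: SU].
    by exists 2 => _ [p _ [q _ <-]]; exact: torus_dist_ubound.
  by exists (tpi z); [exact: SU|exists (tpi w) => //; exact: SU].
suff SE : S `&` ball z0 e = S by move: Sw0; rewrite -SE -ball_normE => -[].
have e0 : 0 < e.
  by have [m _ h] := near_e _ _ Sz0 Sz0; exact: le_lt_trans h.
apply: cS; first by exists z0; split=> //; exact: ballxx.
  by exists (ball z0 e) => //; exact: ball_open.
exists (~` \bigcup_(m in [set m | pint m /\ m != 0]) ball (z0 - m) e).
  by apply: open_closedC; apply: bigcup_open => m _; exact: ball_open.
apply/seteqP; split=> w [Sw hw]; split=> //.
  move=> [m [/andP[m1 m2] m0]]; move: hw; rewrite -!ball_normE /= => h1 h2.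
  have h : `|m| < 1.
    have -> : m = (z0 - w) - (z0 - m - w) by apply: pair_ext => /=; ring.
    by apply: le_lt_trans (ler_normB _ _) _; lra.
  move: h; rewrite pnorm_lt => /andP[/(small_int m1) e1 /(small_int m2) e2].
  by move/eqP: m0; apply; exact: pair_ext.
have [m hm zw] := near_e _ _ Sz0 Sw.
have [mE|m0] := eqVneq m 0.
  by rewrite -ball_normE /=; rewrite mE addr0 in zw.
exfalso; apply: hw; exists m => //.
by rewrite -ball_normE /=; rewrite opprD addrA addrAC in zw.
Qed.

End components.

(** * Dynamics of the wandering components and the coarse height *)

Section wandering.
Local Open Scope quotient_scope.
Variable R : realType.
Local Notation P := (R * R)%type.
Local Notation tpi := (\pi_(torus R) : P -> torus R).
Implicit Types (z m w x y : P) (n : int) (d r : R).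
Variables (f fi : torus R -> torus R) (k : int) (F Fi : P -> P) (rho C : R).
Hypotheses (cfi : continuous fi) (cf : continuous f) (fK : cancel f fi) (fiK : cancel fi f).
Hypotheses (cF : continuous F) (cFi : continuous Fi).
Hypotheses (FK : cancel F Fi) (FiK : cancel Fi F).
Hypothesis eF : equivariant k F.
Hypothesis hF : forall z, tpi (F z) = f (tpi z).
Hypothesis swd : small_wandering_domains f.
Hypothesis irr : irrational rho.
Hypothesis dev : forall z n, `|(ziter F Fi n z - z).2 - n%:~R * rho| <= C.
Local Notation fz := (ziter F Fi).
Local Notation W := (wandering_set f).
Local Notation grp := (lift_group F Fi rho).
Let tG : twist_group k grp C := lift_group_twist cF cFi FK FiK eF dev.

Definition wdom : set P := tpi @^-1` W.
Local Notation O := wdom.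
Local Notation comp := (connected_component wdom).

Lemma wandering_setP p : W p <-> exists2 U, Defs.wandering f U & U p.
Proof.
split=> [h|h]; first by apply: contrapT => n; exact: h.
by move=> n; exact: n h.
Qed.

Lemma wandering_set_open : open W.
Proof.
rewrite openE => p /wandering_setP[U wU Up].
apply: (@filterS _ _ _ U); last by apply: open_nbhs_nbhs; split => //; case: wU.
by move=> q Uq; apply/wandering_setP; exists U.
Qed.

Lemma wdom_open : open O.
Proof. by move/continuousP: (@tpi_continuous R); apply; exact: wandering_set_open. Qed.

Lemma wandering_image (g gi : torus R -> torus R) p : continuous gi ->
  cancel g gi -> cancel gi g -> (forall n q, iterz f n (g q) = g (iterz f n q)) ->
  W p -> W (g p).
Proof.
move=> cgi gK giK comm /wandering_setP[U [oU wU] Up].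
apply/wandering_setP; exists (g @` U); last by exists p.
have gE : g @` U = gi @^-1` U.
  apply/seteqP; split=> [_ [u Uu <-]|q Uq]; first by rewrite /= gK.
  by exists (gi q); rewrite ?giK.
split; first by rewrite gE; move/continuousP: cgi; apply.
move=> n n0; rewrite -subset0 => _ [[_ [u Uu <-] <-] [v Uv]].
rewrite comm => /(can_inj gK) vE.
have : set0 v by rewrite -(wU n n0); split=> //; exists u.
by [].
Qed.

Lemma iterz_comm n q : iterz f n (f q) = f (iterz f n q).
Proof.
rewrite !(iterz_ziter _ fK fiK) -[f q]/(ziter f fi 1 q).
by rewrite -[f _]/(ziter f fi 1 (ziter f fi n q)) -!ziterD // addrC.
Qed.

Lemma iterz_commi n q : iterz f n (fi q) = fi (iterz f n q).
Proof. by apply: (can_inj fK); rewrite -iterz_comm !fiK. Qed.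

Lemma tpi_ziter n z : tpi (fz n z) = ziter f fi n (tpi z).
Proof.
have hFi w : tpi (Fi w) = fi (tpi w) by rewrite -[w in RHS]FiK hF fK.
elim/int_rect: n => [//|n IH|n IH].
- by rewrite /= -/(fz n z) hF IH.
- by rewrite (_ : - n.+1%:Z = - n%:Z - 1) ?ziterB // ?hFi ?IH //; lia.
Qed.

Lemma wdom_grp g n d z : grp g n d -> O z -> O (g z).
Proof.
move=> [m [hm gE _]] Oz; rewrite /wdom /= gE tpi_shift // tpi_ziter.
elim/int_rect: n {gE} => [//|n IH|n IH].
- rewrite -[ziter f fi _ _]/(f (ziter f fi n (tpi z))).
  exact: (wandering_image cfi fK fiK iterz_comm).
- rewrite (_ : - n.+1%:Z = - n%:Z - 1) ?ziterB //; last lia.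
  exact: (wandering_image cf fiK fK iterz_commi).
Qed.

Lemma grp_shift m : pint m -> exists n d, grp (fun z => z + m) n d.
Proof.
move=> hm; exists 0, (0%:~R * rho + m.2).
exact: (lift_groupP F Fi rho 0 hm).
Qed.

Lemma wdom_shift z m : pint m -> O z -> O (z + m).
Proof. by move=> hm Oz; rewrite /wdom /= tpi_shift. Qed.

(** Otherwise the projection of the ball would be a wandering neighbourhood of the projection of
    [p]. *)
Lemma recurrent p (r : R) : ~ O p -> 0 < r -> exists n m x,
  [/\ n != 0, pint m, ball p r x & ball p r (fz n x + m)].
Proof.
move=> nO r0; apply: contrapT => no; apply: nO; apply/wandering_setP.
exists (tpi @` ball p r); last by exists p => //; exact: ballxx.
split; first by apply: tpi_open; exact: ball_open.
move=> n n0; rewrite -subset0 => _ [[_ [x px <-] <-] [y py]].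
rewrite (iterz_ziter _ fK fiK) -tpi_ziter => /tpiP hm.
by apply: no; exists n, (y - fz n x), x; split=> //; rewrite addrC subrK.
Qed.

Lemma comp_open z : open (comp z).
Proof. exact/component_open/wdom_open. Qed.

Lemma comp_bounded z : O z -> exists2 B : R, 0 < B & forall w, comp z w -> `|w| <= B.
Proof.
move=> Oz.
have iC : is_component W (connected_component W (tpi z)) by exists (tpi z).
have [_ _ bd] := swd.1 _ iC.
have Cz : (tpi @^-1` connected_component W (tpi z)) z by exact: connected_component_refl.
have [|B [_ hB]] := bd (connected_component (tpi @^-1` connected_component W (tpi z)) z).
  by exists z.
exists (Num.max 1 (B + 1)); first by rewrite lt_max ltr01.
move=> w zw; apply: (hB (Num.max 1 (B + 1))).
  by rewrite lt_max; apply/orP; right; rewrite ltrDl.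
apply: (@connected_component_max _ _ (comp z)) zw.
- exact: connected_component_refl.
- by move=> v zv; apply: component_map zv => //; exact: tpi_continuous.
- exact: component_connected.
Qed.

Lemma comp_grp g n d z w : grp g n d -> comp z w -> comp (g z) (g w).
Proof.
move=> Gg; apply: component_map; first exact: (tg_cont tG Gg).
by move=> t; exact: wdom_grp Gg.
Qed.

Lemma comp_shift m z w : pint m -> comp z w -> comp (z + m) (w + m).
Proof. by move=> hm; have [n [d Gm]] := grp_shift hm; exact: (comp_grp Gm). Qed.

(** Projections of components of [O] are open, and any two of them are equal or disjoint, so that of
    [comp z] fills the component downstairs. *)
Lemma comp_torus z w : O z -> connected_component W (tpi z) (tpi w) ->
  exists2 m, pint m & comp z (w + m).
Proof.
move=> Oz zw; set Cz := connected_component W (tpi z).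
suff BE : tpi @` comp z = Cz.
  have : Cz (tpi w) by [].
  by rewrite -BE => -[v zv /tpiP hm]; exists (v - w) => //; rewrite addrC subrK.
have sub : tpi @` comp z `<=` Cz.
  by move=> _ [v zv <-]; apply: component_map zv => //; exact: tpi_continuous.
apply: (@component_connected _ W (tpi z)).
- by exists (tpi z); exists z => //; exact: connected_component_refl.
- exists (tpi @` comp z); first by apply: tpi_open; exact: comp_open.
  by rewrite setIC; apply/esym/setIidPl.
- exists (~` (tpi @` \bigcup_(v in [set v | O v /\ ~ (tpi @` comp z) (tpi v)]) comp v)).
    by apply: open_closedC; apply: tpi_open; apply: bigcup_open => v _; exact: comp_open.
  apply/seteqP; split=> q.
    move=> Bq; split; first exact: sub.
    move=> [u [v [Ov nv] vu] uq]; apply: nv.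
    case: Bq => e ze eq; have /tpiP hm : tpi u = tpi e by rewrite uq.
    exists (v - (u - e)); last by apply: tpi_shift; rewrite pintN.
    apply: connected_component_trans ze _; apply: connected_component_sym.
    have hm' : pint (- (u - e)) by rewrite pintN.
    by have := comp_shift hm' vu; rewrite [u - _](_ : _ = e) // opprB addrC subrK.
  move=> [Cq nq]; apply: contrapT => nB; apply: nq.
  have [u uq] := tpi_surj q; rewrite -uq in Cq nB *.
  have Ou : O u by exact: (connected_component_sub Cq).
  exists u => //; exists u; last exact: connected_component_refl.
  by split.
Qed.

(** A return would give a group element mapping the bounded set [comp z] into itself, although its
    displacement [th] is nonzero because [rho] is irrational. *)
Lemma no_return z (d : nat) : O z -> (0 < d)%N ->
  ~ connected_component W (tpi z) (tpi (fz d z)).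
Proof.
move=> Oz d0 /(comp_torus Oz)[m hm zm].
have Gd := lift_groupP F Fi rho d hm.
have [B B0 hB] := comp_bounded Oz.
pose th : R := d%:~R * rho + m.2.
have th0 : th != 0.
  move: (hm) => /andP[_ /intrP[j hj]].
  by rewrite /th hj; apply: irrational_affine => //; lia.
pose g z := fz d z + m.
have gstep w : comp z w -> comp z (g w).
  move=> zw; apply: connected_component_trans zm _.
  by apply: (comp_grp Gd); exact: zw.
have giter (j : nat) : comp z (iter j g z).
  by elim: j => [|j IH]; [exact: connected_component_refl|exact: gstep].
have [gi [_ gK giK]] := tg_inv tG Gd.
pose j := Num.bound ((2 * B + C) / `|th|).
have C0 : 0 <= C by apply: le_trans (dev z 0).
have thp : 0 < `|th| by rewrite normr_gt0.
have h1 : 2 * B + C < j%:R * `|th|.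
  rewrite -ltr_pdivrMr //; apply: archi_boundP; apply: divr_ge0; last exact: ltW.
  by lra.
have := tg_dev tG z (tg_iter tG j Gd gK giK).
rewrite -[ziter _ _ _ z]/(iter j g z) -pmulrn -/th.
have := hB _ (giter j); have := hB _ (connected_component_refl Oz).
rewrite !pnorm_le => /andP[_ h2] /andP[_ h3] h4.
move: h1; rewrite -[j%:R]ger0_norm ?ler0n // -normrM => h1.
set y := iter j g z in h3 h4 *.
have : `|j%:R * th| <= `|y.2| + `|z.2| + `|y.2 - z.2 - j%:R * th|.
  have -> : j%:R * th = y.2 - z.2 - (y.2 - z.2 - j%:R * th) by ring.
  apply: le_trans (ler_normB _ _) _; rewrite opprB addrCA subrr addr0.
  by rewrite lerD2r; exact: ler_normB.
by lra.
Qed.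

Lemma finite_nat_bound (A : set nat) : finite_set A ->
  exists n0 : nat, forall n : nat, (n0 <= n)%N -> ~ A n.
Proof.
move=> /finite_seqP[s ->]; exists (\max_(i <- s) i).+1 => n hn /= ns.
by have := @leq_bigmax_seq _ s xpredT id n ns isT; rewrite leqNgt hn.
Qed.

Lemma wdom_ziter n z : O z -> O (fz n z).
Proof.
have p0 : pint (0 : P) by apply/andP; split; exact: rpred0.
by move=> /(wdom_grp (lift_groupP F Fi rho n p0)); rewrite addr0.
Qed.

Lemma comp_ziter n z w : comp z w -> comp (fz n z) (fz n w).
Proof.
have p0 : pint (0 : P) by apply/andP; split; exact: rpred0.
by move=> /(comp_grp (lift_groupP F Fi rho n p0)); rewrite !addr0.
Qed.

Lemma torus_comp_small z (e : R) : torus_diam (connected_component W (tpi z)) < e ->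
  e <= 1 / 4 -> forall w w', comp z w -> comp z w' -> `|w - w'| < e.
Proof.
move=> he e4; apply: (small_torus_diam (@component_connected _ O z) _ he e4).
by move=> v zv; apply: component_map zv => //; exact: tpi_continuous.
Qed.

(** By [no_return] the forward images lie in distinct components, of which only finitely many have
    diameter at least [e']. The cap [1 / 4] is what [small_torus_diam] needs to pass to the
    plane. *)
Lemma comp_shrink z (e : R) : O z -> 0 < e -> exists n0 : nat, forall n : nat, (n0 <= n)%N ->
  forall w w', comp z w -> comp z w' -> `|fz n w - fz n w'| < e.
Proof.
move=> Oz e0.
pose e' := Num.min e (1 / 4).
have e'0 : 0 < e' by rewrite lt_min e0 divr_gt0.
have e'4 : e' <= 1 / 4 by rewrite ge_min lexx orbT.
pose Cn (n : nat) := connected_component W (tpi (fz n z)).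
pose A := [set D | is_component W D /\ e' <= torus_diam D].
have WO v : O v -> W (tpi v) by [].
have injC (n n' : nat) : (n < n')%N -> Cn n <> Cn n'.
  move=> nn' E; have n'n : (0 < n' - n)%N by rewrite subn_gt0.
  apply: (@no_return (fz n z) (n' - n) _ n'n); first exact: wdom_ziter.
  rewrite -ziterD // (_ : (n' - n)%N%:Z + n = n'); last lia.
  rewrite -/(Cn n) E; apply: connected_component_refl; apply: WO.
  exact: wdom_ziter.
have fin : finite_set (Cn @^-1` A).
  apply: finite_preimage; last exact: swd.2.
  move=> n n' _ _ E; have [nn'|nn'|//] := ltngtP n n'.
    by case: (injC _ _ nn').
  by case: (injC _ _ nn').
have [n0 hn0] := finite_nat_bound fin.
exists n0 => n /hn0 nA w w' zw zw'.
have small : torus_diam (Cn n) < e'.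
  rewrite ltNge; apply/negP => h; apply: nA; split=> //.
  by exists (tpi (fz n z)) => //; apply: WO; exact: wdom_ziter.
have := torus_comp_small small e'4 (comp_ziter n zw) (comp_ziter n zw').
by move=> h; apply: lt_le_trans h _; rewrite ge_min lexx.
Qed.

(** * Asymptotic points *)

Definition asymptotic z w := forall e : R, 0 < e -> exists n0 : nat, forall n : nat, (n0 <= n)%N ->
  `|fz n z - fz n w| <= e.

Lemma asymptotic_sym z w : asymptotic z w -> asymptotic w z.
Proof.
by move=> h e /h[n0 hn]; exists n0 => n /hn; rewrite distrC.
Qed.

Lemma asymptotic_trans z w v : asymptotic z w -> asymptotic w v -> asymptotic z v.
Proof.
move=> h1 h2 e e0; have e2 : 0 < e / 2 by rewrite divr_gt0.
have [n1 hn1] := h1 _ e2; have [n2 hn2] := h2 _ e2.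
exists (maxn n1 n2) => n; rewrite geq_max => /andP[/hn1 a /hn2 b].
rewrite -[fz n z](subrK (fz n w)) -addrA.
by apply: le_trans (ler_normD _ _) _; lra.
Qed.

Lemma asymptotic_closure z w : O z -> closure (comp z) w -> asymptotic z w.
Proof.
move=> Oz clw e e0; have [n0 hn0] := comp_shrink Oz e0.
exists n0 => n /hn0 h; rewrite leNgt; apply/negP => lt.
have op : open [set v | e < `|fz n z - fz n v|].
  apply: (@open_comp _ _ (fun v => `|fz n z - fz n v|) [set t | e < t]); last exact: open_gt.
  move=> v _; apply: (@continuous_comp _ _ _ (fun v => fz n z - fz n v) Num.norm).
    apply: cvgB; first exact: cvg_cst.
    exact: (ziter_continuous cF cFi FK FiK).
  exact: norm_continuous.
have [v [zv ev]] := clw _ (open_nbhs_nbhs (conj op lt)).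
have := h _ _ (connected_component_refl Oz) zv.
by move: ev => /=; lra.
Qed.

(** At a time when the orbits are within [1], each of the two deviations costs at most [C]. *)
Lemma asymptotic_height z w : asymptotic z w -> `|z.2 - w.2| <= 2 * C + 1.
Proof.
move=> /(_ 1 ltr01)[n0 /(_ n0 (leqnn _))]; rewrite pnorm_le => /andP[_ h].
have := dev z n0; have := dev w n0; rewrite /= in h *.
set a := (fz n0 z).2 in h *; set b := (fz n0 w).2 in h *; set t := _ * rho.
have -> : z.2 - w.2 = (b - w.2 - t) - (a - z.2 - t) + (a - b) by ring.
move=> h1 h2; apply: le_trans (ler_normD _ _) _; apply: lerD => //.
by apply: le_trans (ler_normB _ _) _; lra.
Qed.

(** The corrected heights [b i] are bounded. If [z] were asymptotic to its image, [b] would for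
    large [i] change by [- th] every [N] steps, up to an error [|th| / 2], and so drift to
    infinity. *)
Lemma asymptotic_return n m z : pint m -> n != 0 -> ~ asymptotic z (fz n z + m).
Proof.
move=> hm n0; wlog np : n m z hm n0 / 0 < n.
  move=> H; have [|nn|] := ltgtP n 0; [|exact: H|by move=> h; rewrite h in n0].
  move=> nn as1; set w := fz n z + m in as1.
  pose m' := (- m.1 + (- n * k)%:~R * - m.2, - m.2).
  have hm' : pint m' by apply: (@pint_twist _ _ (- m)); rewrite pintN.
  apply: (H (- n) m' w) => //; [by rewrite oppr_eq0|by rewrite oppr_gt0|].
  have -> : fz (- n) w + m' = z; last exact: asymptotic_sym.
  rewrite -[m']/((- m).1 + (- n * k)%:~R * (- m).2, (- m).2).
  by rewrite -(ziter_equivariant FK FiK eF) ?pintN // addrK ziterK.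
move=> as1; have : exists N : nat, n = N by exists `|n|%N; lia.
case=> N nE; rewrite {}nE in as1 np n0.
have N0 : (0 < N)%N by [].
pose th : R := N%:~R * rho + m.2.
have th0 : 0 < `|th|.
  move: (hm) => /andP[_ /intrP[j hj]].
  by rewrite normr_gt0 /th hj; exact: irrational_affine.
have [n1 hn1] := as1 (`|th| / 2) (divr_gt0 th0 (ltr0Sn _ 1)).
pose b (i : nat) := (fz i z).2 - i%:R * rho.
have bb i : `|b i - z.2| <= C.
  have := dev z i; rewrite /b -pmulrn /=.
  by rewrite (_ : _ - _ - z.2 = (fz i z).2 - z.2 - i%:R * rho) //; ring.
have step (i : nat) : (n1 <= i)%N -> `|b (i + N)%N - b i + th| <= `|th| / 2.
  move=> /hn1; rewrite (ziter_equivariant FK FiK eF) // -(ziterD FK FiK) -PoszD pnorm_le.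
  move=> /andP[_]; rewrite -normrN.
  rewrite (_ : - (_ - _).2 = b (i + N)%N - b i + th) //.
  by rewrite /b /th natrD /=; ring.
have steps (J : nat) : `|b (n1 + J * N)%N - b n1 + J%:R * th| <= J%:R * (`|th| / 2).
  elim: J => [|J IH]; first by rewrite addn0 subrr !mul0r addr0 normr0.
  have := step (n1 + J * N)%N (leq_addr _ _).
  rewrite mulSn [(N + _)%N]addnC addnA -[J.+1%:R]natr1 !mulrDl !mul1r => h.
  set x := b (_ + _ + _)%N in h *; set y := b (n1 + _)%N in h IH.
  have -> : x - b n1 + (J%:R * th + th) = (x - y + th) + (y - b n1 + J%:R * th) by ring.
  by apply: le_trans (ler_normD _ _) _; lra.
pose J := Num.bound (2 * C / (`|th| / 2)).
have C0 : 0 <= C by apply: le_trans (dev z 0).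
have : 2 * C < J%:R * (`|th| / 2).
  rewrite -ltr_pdivrMr ?divr_gt0 //; apply: archi_boundP; apply: divr_ge0; first by lra.
  by rewrite divr_ge0 // ltW.
have := steps J; have := bb n1; have := bb (n1 + J * N)%N.
set x := b (_ + _)%N; set y := b n1 => h1 h2 h3 h4.
have : `|J%:R * th| <= `|x - y + J%:R * th| + (`|x - z.2| + `|y - z.2|).
  have {1}-> : J%:R * th = (x - y + J%:R * th) - ((x - z.2) - (y - z.2)) by ring.
  by apply: le_trans (ler_normB _ _) _; rewrite lerD2l; exact: ler_normB.
rewrite normrM ger0_norm ?ler0n //.
have -> : J%:R * `|th| = J%:R * (`|th| / 2) + J%:R * (`|th| / 2) by field.
by lra.
Qed.

(* The boundary of a single component has empty interior in the
   nonwandering set: otherwise all the points of a ball would be asymptotic. *)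
Lemma nonwandering_avoid p (r : R) q : ~ O p -> 0 < r -> O q ->
  exists2 p', ball p r p' & ~ O p' /\ ~ closure (comp q) p'.
Proof.
move=> nO r0 Oq; apply: contrapT => no.
have clq y : ball p r y -> ~ O y -> closure (comp q) y.
  by move=> py nOy; apply: contrapT => ncl; apply: no; exists y.
have as_q y : ball p r y -> asymptotic y q.
  move=> py; have [Oy|nOy] := pselect (O y); last first.
    by apply: asymptotic_sym; apply: asymptotic_closure => //; exact: clq.
  have npy : ~ comp y p by move=> /connected_component_sub.
  have [v [pv yv nOv]] := frontier_in wdom_open (@connected_ball _ p r) Oy py (ballxx _ r0) npy.
  apply: asymptotic_trans (asymptotic_closure Oy yv) _.
  by apply: asymptotic_sym; apply: asymptotic_closure => //; exact: clq.
have [n [m [x [n0 hm px pgx]]]] := recurrent nO r0.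
apply: (@asymptotic_return n m x hm n0).
by apply: asymptotic_trans (as_q _ px) _; apply: asymptotic_sym; exact: as_q.
Qed.

(** Otherwise the plane would be a single component, and components are bounded. *)
Lemma nonwandering_ex : exists p, ~ O p.
Proof.
apply: contrapT => /forallNP all.
have O0 : O 0 by apply: contrapT; exact: all.
have [B B0 hB] := comp_bounded O0.
have : comp 0 ((B + 1, 0) : P).
  apply: (@connected_component_max _ O setT) => //; first by move=> z _; apply: contrapT; exact: all.
  exact: connected_plane.
move=> /hB; rewrite pnorm_le => /andP[/= h _].
by move: h; rewrite ger0_norm; lra.
Qed.

(** * The orbit supremum and a point where it oscillates little *)

Definition top_height z : R := sup [set (fz n z).2 - n%:~R * rho | n in setT].

Lemma top_height_sup z : has_sup [set (fz n z).2 - n%:~R * rho | n in setT].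
Proof.
split; first by exists ((fz 0 z).2 - 0%:~R * rho); exists 0.
exists (z.2 + C) => _ [n _ <-]; have := dev z n; rewrite ler_norml => /andP[_] /=.
by lra.
Qed.

Lemma top_height_ge n z : (fz n z).2 - n%:~R * rho <= top_height z.
Proof. by apply: sup_upper_bound; [exact: top_height_sup|exists n]. Qed.

Lemma top_height_le z (b : R) : (forall n, (fz n z).2 - n%:~R * rho <= b) ->
  top_height z <= b.
Proof.
move=> h; apply: ge_sup; first exact: (top_height_sup z).1.
by move=> _ [n _ <-].
Qed.

Lemma top_height_y z : `|top_height z - z.2| <= C.
Proof.
have := top_height_ge 0 z; rewrite /= mul0r subr0 => h.
have C0 : 0 <= C by apply: le_trans (dev z 0).
rewrite ler_norml; apply/andP; split; first by lra.
rewrite lerBlDr addrC; apply: top_height_le => n.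
by have := dev z n; rewrite ler_norml => /andP[_] /=; lra.
Qed.

Lemma top_height_lsc z (a : R) : a < top_height z -> \forall w \near z, a < top_height w.
Proof.
move=> /(sup_gt (top_height_sup z).1)[_ [n _ <-] an].
have cn : {for z, continuous (fun w => (fz n w).2 - n%:~R * rho)}.
  apply: cvgB; last exact: cvg_cst.
  apply: (@continuous_comp _ _ _ (fz n) snd); last exact: cvg_snd.
  exact: (ziter_continuous cF cFi FK FiK).
have near_z : \forall w \near z, a < (fz n w).2 - n%:~R * rho.
  exact: cn _ (open_nbhs_nbhs (conj (@open_gt _ a) an)).
by apply: filterS near_z => w h; apply: lt_le_trans h (top_height_ge n w).
Qed.

Lemma top_height_grp g n d z : grp g n d -> top_height (g z) = top_height z + d.
Proof.
have le g1 n1 d1 z1 : grp g1 n1 d1 -> top_height (g1 z1) <= top_height z1 + d1.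
  move=> [m [hm gE ->]]; apply: top_height_le => j; rewrite gE.
  rewrite (ziter_equivariant FK FiK eF) // -(ziterD FK FiK) /=.
  by have := top_height_ge (j + n1) z1; rewrite rmorphD /= mulrDl; lra.
move=> Gg; apply/eqP; rewrite eq_le (le _ _ _ _ Gg) /=.
have [gi [Ggi gK giK]] := tg_inv tG Gg.
by have := le _ _ _ (g z) Ggi; rewrite gK; lra.
Qed.

(** One step of the Baire construction. Where [top_height] is within [e] of its supremum over the
    nonwandering points of a ball, lower semicontinuity keeps it so nearby. *)
Lemma osc_step p (r e : R) q : ~ O p -> 0 < r -> 0 < e -> exists p' (r' : R),
  [/\ ~ O p', 0 < r', (forall w, `|p' - w| <= r' -> ball p r w),
      (forall w w', ~ O w -> ~ O w' -> ball p' r' w -> ball p' r' w' ->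
         `|top_height w - top_height w'| <= e) &
      (forall w, ball p' r' w -> ~ comp q w)].
Proof.
move=> nOp r0 e0.
have [p1 pp1 [nO1 ncl]] : exists2 p', ball p r p' & ~ O p' /\ ~ closure (comp q) p'.
  have [Oq|nOq] := pselect (O q); first exact: nonwandering_avoid.
  exists p; [exact: ballxx|split=> //].
  by rewrite connected_component_out // closure0.
have : nbhs p1 (ball p r `&` ~` closure (comp q)).
  apply: open_nbhs_nbhs; split=> //; apply: openI; first exact: ball_open.
  exact/closed_openC/closed_closure.
move=> /nbhs_ballP[r1 /= r10 hr1].
pose S := [set top_height w | w in [set w | ~ O w /\ ball p1 r1 w]].
have hS : has_sup S.
  split; first by exists (top_height p1); exists p1 => //; split=> //; exact: ballxx.
  exists (p1.2 + r1 + C) => _ [w [_ p1w] <-].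
  have := top_height_y w; rewrite ler_norml => /andP[_ h].
  move: p1w; rewrite -ball_normE /= pnorm_lt => /andP[_ /=]; rewrite ltr_norml => /andP[h1 _].
  by lra.
have [_ [p' [nO' p1p'] <-] hp'] := sup_adherent e0 hS.
have : nbhs p' (ball p1 r1 `&` [set w | sup S - e < top_height w]).
  apply: filterI; first by apply: open_nbhs_nbhs; split=> //; exact: ball_open.
  exact: top_height_lsc.
move=> /nbhs_ballP[r2 /= r20 hr2].
(* Halving the radius leaves room for the closed ball, so that limits of nested centres are not
   lost. *)
exists p', (r2 / 2); split=> //; first by rewrite divr_gt0.
- move=> w p'w; apply: (hr1 w _).1; apply: (hr2 w _).1.
  by rewrite -ball_normE /=; apply: le_lt_trans p'w _; lra.
- have sub w : ball p' (r2 / 2) w -> ball p' r2 w.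
    by rewrite -!ball_normE /= => h; apply: lt_trans h _; lra.
  have up w : ~ O w -> ball p' (r2 / 2) w -> sup S - e < top_height w <= sup S.
    move=> nOw /sub/hr2[b1 h]; rewrite h /=; apply: sup_upper_bound => //.
    by exists w.
  move=> w w' nw nw' /(up _ nw)/andP[h1 h2] /(up _ nw')/andP[h3 h4].
  by rewrite ler_norml; apply/andP; split; lra.
- move=> w p'w zw; have p'w2 : ball p' r2 w.
    by move: p'w; rewrite -!ball_normE /= => h; apply: lt_trans h _; lra.
  by have [/hr1[_ ncl'] _] := hr2 _ p'w2; apply: ncl'; exact: subset_closure.
Qed.

Lemma rational_point z : O z -> exists ab : rat * rat,
  comp z ((ratr ab.1, ratr ab.2) : P).
Proof.
move=> Oz; have := open_nbhs_nbhs (conj (@comp_open z) (connected_component_refl Oz)).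
move=> /nbhs_ballP[r /= r0 hr].
have [|a /[!in_itv]/= /andP[a1 a2]] := @rat_in_itvoo R z.1 (z.1 + r); first by lra.
have [|b /[!in_itv]/= /andP[b1 b2]] := @rat_in_itvoo R z.2 (z.2 + r); first by lra.
exists (a, b); apply: hr; rewrite -ball_normE /= pnorm_lt /= !ltr_norml.
by apply/andP; split; apply/andP; split; lra.
Qed.

Lemma generic_point : exists p, [/\ ~ O p, (forall z, O z -> ~ closure (comp z) p) &
  forall e : R, 0 < e -> exists2 r : R, 0 < r &
    forall w w', ~ O w -> ~ O w' -> ball p r w -> ball p r w' ->
      `|top_height w - top_height w'| <= e].
Proof.
have [p0 nO0] := nonwandering_ex.
(* At indices that code nothing, [0] is one more point whose component gets avoided. *)
pose q (i : nat) : P := if unpickle i is Some ab then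
  let: (a, b) := (ab : rat * rat) in (ratr a, ratr b) else 0.
pose Phi (i : nat) (s t : P * R) := [/\ ~ O t.1, 0 < t.2,
  (forall w, `|t.1 - w| <= t.2 -> ball s.1 s.2 w),
  (forall w w', ~ O w -> ~ O w' -> ball t.1 t.2 w -> ball t.1 t.2 w' ->
     `|top_height w - top_height w'| <= i.+1%:R^-1) &
  (forall w, ball t.1 t.2 w -> ~ comp (q i) w)].
have /choice[nxt hnxt] : forall a : nat * (P * R), exists t : P * R,
    ~ O a.2.1 -> 0 < a.2.2 -> Phi a.1 a.2 t.
  move=> [i [p r]] /=; have [[nOp r0]|no] := pselect (~ O p /\ 0 < r); last first.
    by exists (p, r) => nOp r0; exfalso; apply: no.
  have [|p' [r' h]] := @osc_step p r i.+1%:R^-1 (q i) nOp r0; first by rewrite invr_gt0.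
  by exists (p', r').
pose xs := fix xs (i : nat) : P * R := if i is j.+1 then nxt (j, xs j) else (p0, 1).
have inv (i : nat) : ~ O (xs i).1 /\ 0 < (xs i).2.
  elim: i => [|i [h1 h2]] /=; first by split.
  by have [] := hnxt (i, xs i) h1 h2.
have step (i : nat) : Phi i (xs i) (xs i.+1) by have [h1 h2] := inv i; exact: hnxt.
have nest (i j : nat) : (i <= j)%N -> ball (xs j).1 (xs j).2 `<=` ball (xs i).1 (xs i).2.
  elim: j => [|j IH]; first by rewrite leqn0 => /eqP ->.
  rewrite leq_eqVlt => /orP[/eqP ->//|/IH h] w hw; apply: h.
  have [_ _ h _ _] := step j; apply: h; apply: ltW.
  by move: hw; rewrite -ball_normE.
have mem (i j : nat) : (i <= j)%N -> ball (xs i).1 (xs i).2 (xs j).1.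
  by move=> /nest; apply; apply: ballxx; have [] := inv j.
pose Q : set P := `[p0.1 - 1, p0.1 + 1]%classic `*` `[p0.2 - 1, p0.2 + 1]%classic.
have kQ : compact Q by apply: compact_setX; exact: segment_compact.
have FQ : ((fun j => (xs j).1) @ \oo) Q.
  exists 0%N => // j _ /=; have := mem 0%N j (leq0n _).
  rewrite -ball_normE /= pnorm_lt /= !ltr_norml => /andP[/andP[h1 h2] /andP[h3 h4]].
  by split; rewrite /= in_itv /=; apply/andP; split; lra.
have [p [_ cp]] := kQ _ _ FQ.
(* The centres cluster at [p], and the closed-ball clause of [Phi] puts [p] inside every open
   ball. *)
have inb (i : nat) : ball (xs i).1 (xs i).2 p.
  have [_ _ h _ _] := step i; apply: h; rewrite leNgt; apply/negP => lt.
  have op : open [set v : P | (xs i.+1).2 < `|(xs i.+1).1 - v|].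
    apply: (@open_comp _ _ (fun v : P => `|(xs i.+1).1 - v|) [set t | (xs i.+1).2 < t]);
      last exact: open_gt.
    move=> v _; apply: (@continuous_comp _ _ _ (fun v : P => (xs i.+1).1 - v) Num.norm).
      by apply: cvgB; [exact: cvg_cst|exact: cvg_id].
    exact: norm_continuous.
  have ev : ((fun j => (xs j).1) @ \oo) (ball (xs i.+1).1 (xs i.+1).2).
    by exists i.+1 => // j /=; exact: mem.
  have [v [+ /= hv]] := cp _ _ ev (open_nbhs_nbhs (conj op lt)).
  by rewrite -ball_normE /= => h'; have := lt_trans h' hv; rewrite ltxx.
exists p; split.
- move=> Op; have ev : ((fun j => (xs j).1) @ \oo) (~` O).
    by exists 0%N => // j _ /=; have [] := inv j.
  by have [v []] := cp _ _ ev (open_nbhs_nbhs (conj wdom_open Op)).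
- move=> z Oz clz; have [ab zab] := rational_point Oz.
  have [_ _ _ _ h] := step (pickle ab).
  have qE : q (pickle ab) = (ratr ab.1, ratr ab.2).
    by rewrite /q pickleK; case: (ab).
  have [v [zv hv]] := clz _ (open_nbhs_nbhs (conj (@ball_open _ _ _ _) (inb (pickle ab).+1))).
  apply: (h v hv); rewrite qE.
  by apply: connected_component_trans zv; apply: connected_component_sym.
- move=> e e0; pose i := Num.bound e^-1.
  have ie : i.+1%:R^-1 <= e.
    rewrite -[e]invrK lef_pV2 ?posrE ?invr_gt0 //.
    apply/ltW; apply: (@lt_trans _ _ i%:R); last by rewrite ltr_nat.
    by apply: archi_boundP; rewrite invr_ge0 ltW.
  have /nbhs_ballP[r /= r0 hr] :=
    open_nbhs_nbhs (conj (@ball_open _ _ _ _) (inb i.+1)).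
  exists r => // w w' nw nw' pw pw'.
  have [_ _ _ h _] := step i.
  by apply: le_trans (h _ _ nw nw' (hr _ pw) (hr _ pw')) ie.
Qed.

Lemma nonint_open : open [set x : R | x \isn't a Num.int].
Proof.
rewrite openE => a /= na.
have /andP[h1 h2] := floor_itv a; rewrite rmorphD /= in h2.
set j : R := (Num.floor a)%:~R in h1 h2.
have ja : j < a.
  by rewrite lt_neqAle h1 andbT; apply: contra na => /eqP <-; exact: intr_int.
have r0 : 0 < Num.min (a - j) (j + 1 - a) by rewrite lt_min; apply/andP; split; lra.
apply/nbhs_ballP; exists (Num.min (a - j) (j + 1 - a)) => //= b.
rewrite -ball_normE /= lt_min !ltr_norml => /andP[/andP[h3 h4] /andP[h5 h6]].
apply/negP => ib; have : b - j \is a Num.int by rewrite rpredB // intr_int.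
move=> /small_int h.
have : b - j = 0 by apply: h; rewrite ltr_norml; apply/andP; split; lra.
by lra.
Qed.

Lemma nonpint_open : open [set v : P | ~ pint v].
Proof.
rewrite (_ : [set v : P | ~ pint v] = fst @^-1` [set x : R | x \isn't a Num.int] `|`
    snd @^-1` [set x : R | x \isn't a Num.int]).
  by apply: openU; apply: open_comp; try exact: nonint_open; move=> v _;
    [exact: cvg_fst|exact: cvg_snd].
apply/seteqP; split=> v /=; first by move/negP; rewrite /pint negb_and => /orP.
by move=> /orP; rewrite -negb_and => /negP.
Qed.

Lemma closure_comp_map (g : P -> P) n d z w : grp g n d -> closure (comp z) w ->
  closure (comp (g z)) (g w).
Proof.
move=> Gg clw B nB.
have [v [zv Bv]] := clw _ (tg_cont tG Gg nB).
by exists (g v); split=> //; exact: comp_grp Gg zv.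
Qed.

(** Every integer translate of [closure (comp z)] is the closure of a component and misses [p];
    compactness of the closure makes this uniform near [p]. *)
Lemma comp_near p z : O z -> (forall v, O v -> ~ closure (comp v) p) ->
  \forall v \near p, ~ connected_component W (tpi z) (tpi v).
Proof.
move=> Oz np.
have kK : compact (closure (comp z)).
  have [B B0 hB] := comp_bounded Oz.
  have kQ : compact (`[- B, B]%classic `*` `[- B, B]%classic : set P).
    by apply: compact_setX; exact: segment_compact.
  apply: (subclosed_compact _ kQ); first exact: closed_closure.
  have clQ : closed (`[- B, B]%classic `*` `[- B, B]%classic : set P).
    by apply: compact_closed kQ; exact: norm_hausdorff.
  rewrite closureE => v; apply; split=> // w /hB; rewrite pnorm_le !ler_norml.
  by move=> /andP[h1 h2]; split; rewrite /= in_itv.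
have := (compact_near_coveringP _).1 kK P (nbhs p) (fun v w => ~ pint (w - v)).
move=> cov; unshelve epose proof (cov _ _) as K.
- move=> w clw.
  have nwp : ~ pint (w - p).
    move=> hm; have hm' : pint (- (w - p)) by rewrite pintN.
    have [n [d Gm]] := grp_shift hm'.
    have E : w + - (w - p) = p by rewrite opprB subrKC.
    have := closure_comp_map Gm clw; rewrite E => cl.
    by apply: (np _ _ cl); exact: wdom_shift.
  have cs : {for (w, p), continuous (fun wv : P * P => wv.1 - wv.2)}.
    by apply: cvgB; [exact: cvg_fst|exact: cvg_snd].
  have := cs _ (open_nbhs_nbhs (conj nonpint_open nwp)).
  by [].
- apply: filterS K => v hv /(comp_torus Oz)[m hm zm].
  apply: (hv (v + m)); first exact: subset_closure.
  by rewrite addrAC subrr add0r.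
Qed.

(** Only finitely many components are large, and [comp_near] keeps each of them away from [p]. *)
Lemma comp_small_near p (e : R) : (forall v, O v -> ~ closure (comp v) p) -> 0 < e ->
  \forall z \near p, forall w w', comp z w -> comp z w' -> `|w - w'| < e.
Proof.
move=> np e0.
pose e' := Num.min e (1 / 4).
have e'0 : 0 < e' by rewrite lt_min e0 divr_gt0.
have e'4 : e' <= 1 / 4 by rewrite ge_min lexx orbT.
have fin := swd.2 _ e'0.
have ev : \forall z \near p, forall D, (is_component W D /\ e' <= torus_diam D) -> ~ D (tpi z).
  have [s sE] := (finite_seqP _).1 fin.
  have {fin} : forall D, D \in s -> is_component W D.
    move=> D Ds; have : [set` s] D by [].
    by rewrite -sE => -[].
  have sub D : (is_component W D /\ e' <= torus_diam D) -> D \in s.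
    by move=> h; have : [set` s] D by rewrite -sE.
  move=> hs.
  suff : \forall z \near p, forall D, D \in s -> ~ D (tpi z).
    by apply: filterS => z h D /sub; exact: h.
  elim: s hs {sub sE} => [|D s IH] hs; first by apply: filterS (nbhsx_ballx p 1 ltr01) => z _ D; rewrite in_nil.
  have nD : \forall z \near p, ~ D (tpi z).
    have [q Wq ->] := hs D (mem_head _ _); have [u uq] := tpi_surj q.
    by rewrite -uq; apply: comp_near => //; rewrite /wdom /= uq.
  have ns := IH (fun D' h => hs D' (mem_behead (s := D :: s) h)).
  apply: filterS2 nD ns => z h1 h2 D'; rewrite inE => /orP[/eqP ->//|]; exact: h2.
apply: filterS ev => z h w w' zw zw'.
have Oz : O z.
  by apply: contrapT => /connected_component_out E; move: zw; rewrite E.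
have small : torus_diam (connected_component W (tpi z)) < e'.
  rewrite ltNge; apply/negP => ge; apply: (h _ (conj _ ge)).
    by exists (tpi z).
  exact: connected_component_refl.
apply: lt_le_trans (torus_comp_small small e'4 zw zw') _.
by rewrite ge_min lexx.
Qed.

(** The nonwandering points from which [z] inherits its height: all of them are asymptotic to [z],
    and a nonwandering [z] is its own front. *)
Definition front z : set P :=
  [set w | ~ O w /\ (w = z \/ (O z /\ closure (comp z) w))].

Lemma front_ex z : front z !=set0.
Proof.
have [Oz|nOz] := pselect (O z); last by exists z; split=> //; left.
have [p nOp] := nonwandering_ex.
have np : ~ comp z p by move=> /connected_component_sub.
have [y [_ zy nOy]] := @frontier_in R O setT z p wdom_open (@connected_plane R) Oz I I np.
by exists y; split=> //; right.
Qed.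

Lemma front_asymptotic z w : front z w -> asymptotic z w.
Proof.
move=> [_ [->|[Oz clw]]]; last exact: asymptotic_closure.
by move=> e e0; exists 0%N => n _; rewrite subrr normr0 ltW.
Qed.

Lemma front_grp g n d z w : grp g n d -> front z w -> front (g z) (g w).
Proof.
move=> Gg [nOw h]; have [gi [Ggi gK giK]] := tg_inv tG Gg.
split; first by move=> /(wdom_grp Ggi); rewrite gK.
case: h => [->|[Oz clw]]; [by left|right]; split; first exact: wdom_grp Gg Oz.
exact: closure_comp_map Gg clw.
Qed.

(* [top_height] on the nonwandering set, made constant on each wandering component. *)
Definition coarse_height z : R := sup (top_height @` front z).

Lemma front_height z w : front z w -> `|top_height w - z.2| <= 3 * C + 1.
Proof.
move=> /front_asymptotic/asymptotic_height h1; have h2 := top_height_y w.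
have -> : top_height w - z.2 = (top_height w - w.2) - (z.2 - w.2) by ring.
by apply: le_trans (ler_normB _ _) _; lra.
Qed.

Lemma coarse_height_sup z : has_sup (top_height @` front z).
Proof.
split; first by have [w zw] := front_ex z; exists (top_height w); exists w.
exists (z.2 + (3 * C + 1)) => _ [w /front_height + <-]; rewrite ler_norml => /andP[_].
by lra.
Qed.

Lemma coarse_height_bound z (a b : R) :
  (forall w, front z w -> a <= top_height w <= b) -> a <= coarse_height z <= b.
Proof.
move=> h; have [w zw] := front_ex z; apply/andP; split.
  have /andP[aw _] := h _ zw; apply: le_trans aw _.
  by apply: sup_upper_bound; [exact: coarse_height_sup|exists w].
apply: ge_sup; first exact: (coarse_height_sup z).1.
by move=> _ [v /h/andP[_ hv] <-].
Qed.

Lemma coarse_height_y z : `|coarse_height z - z.2| <= 3 * C + 1.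
Proof.
have := @coarse_height_bound z (z.2 - (3 * C + 1)) (z.2 + (3 * C + 1)).
move=> /(_ _)/andP[|h1 h2]; last by rewrite ler_norml; apply/andP; split; lra.
move=> w /front_height; rewrite ler_norml => /andP[h1 h2].
by apply/andP; split; lra.
Qed.

Lemma coarse_height_grp g n d z : grp g n d -> coarse_height (g z) = coarse_height z + d.
Proof.
have le g1 n1 d1 z1 : grp g1 n1 d1 -> coarse_height z1 + d1 <= coarse_height (g1 z1).
  move=> Gg; rewrite -lerBrDr; apply: ge_sup; first exact: (coarse_height_sup z1).1.
  move=> _ [w zw <-]; rewrite lerBrDr -(top_height_grp w Gg).
  apply: sup_upper_bound; first exact: coarse_height_sup.
  by exists (g1 w) => //; exact: front_grp Gg zw.
move=> Gg; apply/eqP; rewrite eq_le (le _ _ _ _ Gg) andbT.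
have [gi [Ggi gK giK]] := tg_inv tG Gg.
by have := le _ _ _ (g z) Ggi; rewrite gK; lra.
Qed.

(** Components near [p] are smaller than [r / 2], so the front of a point within [r / 2] of [p]
    stays in the ball where [top_height] oscillates little on nonwandering points. *)
Lemma coarse_height_continuous p : ~ O p -> (forall z, O z -> ~ closure (comp z) p) ->
  (forall e : R, 0 < e -> exists2 r : R, 0 < r &
    forall w w', ~ O w -> ~ O w' -> ball p r w -> ball p r w' ->
      `|top_height w - top_height w'| <= e) ->
  {for p, continuous coarse_height}.
Proof.
move=> nOp np osc; apply/cvgrPdist_lt => e e0.
have e2 : 0 < e / 2 by rewrite divr_gt0.
have [r r0 hr] := osc _ e2.
have r2 : 0 < r / 2 by rewrite divr_gt0.
have pE : coarse_height p = top_height p.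
  have : top_height p <= coarse_height p <= top_height p.
    by apply: coarse_height_bound => w [_ [->|[/nOp//]]]; rewrite lexx.
  by move=> h; apply/eqP; rewrite eq_le andbC.
apply: filterS2 (comp_small_near np r2) (nbhsx_ballx p _ r2) => z small pz.
have inb w : front z w -> ball p r w.
  move: pz; rewrite -!ball_normE /= => pz [_ [->|[Oz clw]]]; first by lra.
  have gap : 0 < r / 2 - `|p - z| by rewrite subr_gt0.
  have [v [zv]] := clw _ (nbhsx_ballx w _ gap).
  rewrite -ball_normE /= => wv.
  have := small _ _ (connected_component_refl Oz) zv.
  have -> : p - w = (p - z) + (z - v) - (w - v) by apply: pair_ext => /=; ring.
  have := ler_normB ((p - z) + (z - v)) (w - v); have := ler_normD (p - z) (z - v).
  by lra.
have : top_height p - e / 2 <= coarse_height z <= top_height p + e / 2.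
  apply: coarse_height_bound => w zw; have [nOw _] := zw.
  have := hr _ _ nOp nOw (ballxx _ r0) (inb _ zw); rewrite ler_norml => /andP[h1 h2].
  by apply/andP; split; lra.
by rewrite pE => /andP[h1 h2]; rewrite ltr_norml; apply/andP; split; lra.
Qed.

Lemma deviation_height : k != 0 -> exists2 h : P -> R, continuous h &
  (forall z, h (F z) = h z + rho) /\ (forall z m, pint m -> h (z + m) = h z + m.2).
Proof.
move=> k0; have [p [nOp np osc]] := generic_point.
have irrg g n d : grp g n d -> n != 0 -> d != 0.
  move=> [m [/andP[_ /intrP[j hj]] _ ->]] n0; rewrite hj.
  exact: irrational_affine.
have rec (r : R) : 0 < r -> exists g n d x,
    [/\ grp g n d, n != 0, ball p r x & ball p r (g x)].
  move=> r0; have [n [m [x [n0 hm px pgx]]]] := recurrent nOp r0.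
  exists (fun z => fz n z + m), n, (n%:~R * rho + m.2), x; split=> //.
  exact: lift_groupP.
have [h ch hh] := equivariant_height tG coarse_height_grp k0 coarse_height_y irrg
  (coarse_height_continuous nOp np osc) rec.
exists h => //; split=> [z|z m hm].
  have p0 : pint (0 : P) by apply/andP; split; exact: rpred0.
  have := hh _ _ _ z (lift_groupP F Fi rho 1 p0).
  by rewrite addr0 /= mul1r addr0.
by have := hh _ _ _ z (lift_groupP F Fi rho 0 hm); rewrite mul0r add0r.
Qed.

End wandering.

(** * From an equivariant height to the factor map *)

Section factor.
Variable R : realType.
Local Open Scope quotient_scope.
Local Notation P := (R * R)%type.
Local Notation cpi := (\pi_(circle R) : R -> circle R).
Local Notation tpi := (\pi_(torus R) : P -> torus R).

Lemma height_factor (f : torus R -> torus R) (F : P -> P) (h : P -> R) (rho : R) :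
  irrational rho -> continuous h -> (forall z, tpi (F z) = f (tpi z)) ->
  (forall z, h (F z) = h z + rho) ->
  (forall z m, pint m -> h (z + m) = h z + m.2) -> irrational_rotation_factor f.
Proof.
move=> irr ch hF hrho hm.
pose g (p : torus R) : circle R := cpi (h (repr p)).
have gE z : g (tpi z) = cpi (h z).
  have /tpiP hz : tpi (repr (tpi z)) = tpi z by rewrite reprK.
  rewrite /g -[repr (tpi z)](subrK z) addrC hm //; apply/cpiP.
  by rewrite addrAC subrr add0r; case/andP: hz.
exists rho, g; split=> //.
- apply/quotient_continuous => z; rewrite /continuous_at.
  have -> : g \o tpi = cpi \o h by apply/funext.
  by apply: continuous_comp; [exact: ch|exact: cpi_continuous].
(* Along a vertical line [h] grows by [1] per unit, so by the intermediate value theorem it takes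
   the value [x]. *)
- move=> t; have [x xt] := cpi_surj t.
  pose v (y : R) := h ((0, y) : P).
  have cv : continuous v.
    move=> y; apply: (@continuous_comp _ _ _ (fun y : R => (0, y) : P) h); last exact: ch.
    by apply: cvg_pairR; [exact: cvg_cst|exact: cvg_id].
  have vN (j : int) : v j%:~R = h 0 + j%:~R.
    rewrite -[RHS](hm 0 (0, j%:~R)) ?add0r //.
    by apply/andP; split; [exact: rpred0|exact: intr_int].
  pose N : nat := Num.bound `|x - h 0|.
  have xN : `|x - h 0| < N%:R by apply: archi_boundP.
  have [] := @IVT R v (- N%:R) N%:R x.
  + by rewrite ge0_cp.
  + exact: continuous_subspaceT.
  + have := vN N; have := vN (- N%:Z); rewrite rmorphN /= -pmulrn => -> ->.
    move: xN; rewrite ltr_norml => /andP[h1 h2].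
    by rewrite ge_min le_max; apply/andP; split; apply/orP; [left|right]; lra.
  + by move=> y _ vy; exists (tpi (0, y)); rewrite gE -/(v y) vy.
- move=> p; have [z <-] := tpi_surj p.
  by rewrite -hF !gE hrho rotationE.
Qed.

End factor.

Theorem corollary1p2 (R : realType) (k : int) (f : torus R -> torus R) :
  k != 0 ->
  is_homeo f ->
  isotopic R (dehn_twist k) f ->
  small_wandering_domains f ->
  (irrational_rotation_factor f <->
   forall F : R * R -> R * R, is_lift f F ->
     exists rho C : R, [/\ irrational rho, 0 < C &
       forall (z : R * R) (n : int),
         `| (iterz F n z - z).2 - n%:~R * rho | <= C]).
Proof.
move=> k0 hf iso swd; split=> [fac F lF|dev].
  exact: factor_deviation k0 hf lF (lift_equivariant iso lF) fac.
(* The deviation bound is assumed for all lifts; it is applied to the lift obtained from the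
   isotopy. *)
have [F [lF eF]] := lift_ex iso.
have [rho [C [irr _ devF]]] := dev F lF.
have [Fi [cFi FK FiK]] := lift_homeo hf lF eF.
have [cf [fi [cfi fK fiK]]] := hf; have [cF hF] := lF.
have devz z (n : int) : `|(ziter F Fi n z - z).2 - n%:~R * rho| <= C.
  by rewrite -(iterz_ziter n FK FiK).
have [h ch [hrho hm]] :=
  deviation_height cfi cf fK fiK cF cFi FK FiK eF hF swd irr devz k0.
exact: height_factor irr ch hF hrho hm.
Qed.
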